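(* Let $(A,m,\sigma)$ be a braided algebra and let $\Join_\sigma$ be the quantum quasi-shuffle product on $T(A)$. For any $n\geq 1$ and $a_1,\ldots,a_n\in A$, $$a_1\Join_\sigma\cdots\Join_\sigma a_n=\sum_{(w,S)\in\overline{\mathfrak{S}}_n}T_{(w,S)}^\sigma(a_1\otimes \cdots\otimes a_{n}),$$ where $T^\sigma_{(w,S)}=m_{\mathrm{cp}(S)}\circ T^\sigma_w$. Therefore the subalgebra $S^{qsh}_\sigma(A)$ of $(T(A),\Join_\sigma)$ generated by $A$ satisfies $$S^{qsh}_\sigma(A)=\sum_{n\geq 0}\mathrm{Im}\Big(\sum_{(w,S)\in\overline{\mathfrak{S}}_n}T_{(w,S)}^\sigma\Big),$$ where the term for $n=0$ is understood to be $\mathbb{K}=A^{\otimes 0}$.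
   Context: $\mathbb{K}$ is a field of characteristic $0$; everything is over $\mathbb{K}$. Algebras are associative, not necessarily unital. A braiding on a vector space $V$ is an invertible linear map $\sigma\in\mathrm{End}(V\otimes V)$ with $(\sigma\otimes \mathrm{id})(\mathrm{id}\otimes \sigma)(\sigma\otimes \mathrm{id})=(\mathrm{id}\otimes \sigma)(\sigma\otimes \mathrm{id})(\mathrm{id}\otimes \sigma)$ on $V^{\otimes 3}$. Write $\sigma_k=\mathrm{id}_V^{\otimes k-1}\otimes\sigma\otimes\mathrm{id}_V^{\otimes n-k-1}$ on $V^{\otimes n}$. A braided algebra $(A,m,\sigma)$ is an algebra $(A,m)$ with a braiding $\sigma$ on $A$ such that $(\mathrm{id}_A\otimes m)\sigma_1\sigma_2=\sigma(m\otimes\mathrm{id}_A)$ and $(m\otimes\mathrm{id}_A)\sigma_2\sigma_1=\sigma(\mathrm{id}_A\otimes m)$ on $A^{\otimes 3}$. $\mathfrak{S}_n$ is the symmetric group on $\{1,\dots,n\}$ (products are composition of maps, the right factor acting first), with generators $s_k=(k\ k{+}1)$. For $w\in\mathfrak{S}_n$ with reduced expression $w=s_{k_1}\cdots s_{k_l}$, put $T^\sigma_w=\sigma_{k_1}\cdots\sigma_{k_l}\in\mathrm{End}(A^{\otimes n})$ (independent of the reduced expression). For $i,j\ge1$, $\chi_{ij}\in\mathfrak{S}_{i+j}$ is the permutation with $\chi_{ij}(r)=j+r$ for $1\le r\le i$ and $\chi_{ij}(i+r)=r$ for $1\le r\le j$; $\beta_{i,j}=T^\sigma_{\chi_{ij}}:A^{\otimes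 i}\otimes A^{\otimes j}\to A^{\otimes j}\otimes A^{\otimes i}$, and $\beta_{0,i}=\beta_{i,0}=\mathrm{id}$. Quantum quasi-shuffle product: $\Join_\sigma$ is the bilinear product on $T(A)=\bigoplus_{n\ge0}A^{\otimes n}$ such that scalars $\lambda\in\mathbb{K}=A^{\otimes 0}$ act by $\lambda\Join_\sigma x=x\Join_\sigma\lambda=\lambda x$, and, with $\Join_{\sigma(i,j)}$ denoting its restriction to $A^{\otimes i}\otimes A^{\otimes j}$, recursively for $i,j\ge1$ (with $u=a_1\otimes\cdots\otimes a_i$ and $v=b_1\otimes\cdots\otimes b_j$): $$u\Join_\sigma v=a_1\otimes\big((a_2\otimes\cdots\otimes a_i)\Join_\sigma v\big)+(\mathrm{id}_A\otimes\Join_{\sigma(i,j-1)})(\beta_{i,1}\otimes\mathrm{id}_A^{\otimes j-1})(u\otimes v)+(m\otimes\Join_{\sigma(i-1,j-1)})(\mathrm{id}_A\otimes\beta_{i-1,1}\otimes\mathrm{id}_A^{\otimes j-1})(u\otimes v),$$ where an empty tensor is $1\in\mathbb{K}$. It is known that $(T(A),\Join_\sigma)$ is an associative algebra with unit $1\in\mathbb{K}$; subalgebras are taken to contain this unit. For $w\in\mathfrak{S}_n$ let $\mathcal{S}^w=\{(k,k+1)\mid 1\le k<n,\ w^{-1}(k)<w^{-1}(k+1)\}$ and let $\overline{\mathfrak{S}}_n=\{(w,S)\mid w\in\mathfrak{S}_n,\ S\subset\mathcal{S}^w\}$. For $(w,S)\in\overline{\mathfrak{S}}_n$, $\mathrm{cp}(S)$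 is the composition of $n$ obtained by cutting $1,2,\dots,n$ into consecutive intervals so that $k$ and $k+1$ lie in the same interval if and only if $(k,k+1)\in S$, and listing the lengths of these intervals in order. (Example: $n=9$, $S=\{(1,2),(2,3),(6,7),(8,9)\}$ gives $\mathrm{cp}(S)=(3,1,1,2,2)$.) Define $m^0=\mathrm{id}_A$, $m^1=m$, $m^k=m(\mathrm{id}_A\otimes m^{k-1}):A^{\otimes k+1}\to A$. For a composition $I=(i_1,\dots,i_k)$ of $n$ (positive integers with sum $n$), $m_I=m^{i_1-1}\otimes\cdots\otimes m^{i_k-1}$. *)

(* Defs.v *)
From HB Require Import structures.
From mathcomp Require Import all_boot all_order all_algebra all_fingroup.
From mathcomp Require Import ring_quotient sesquilinear.
From mathcomp Require Import boolp classical_sets.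
From mathcomp Require Import finmap monalg.

Set Implicit Arguments.
Unset Strict Implicit.
Unset Printing Implicit Defensive.

Import GRing.Theory.
Local Open Scope ring_scope.

(** * The tensor algebra T(A)

    T(A) is the free vector space on the words in A, divided by the
    multilinearity relations; the class of the word [:: a_1; ...; a_n] is
    a_1 (x) ... (x) a_n and the empty word is the unit 1 of K. *)

Section FreeWords.
Context (K : fieldType) (A : lmodType K).

Definition multilinear (W : lmodType K) (f : seq A -> W) : Prop :=
  forall (s t : seq A) (c : K) (a b : A),
    f (s ++ (c *: a + b) :: t) = c *: f (s ++ a :: t) + f (s ++ b :: t).

Inductive tens_rel : {malg K[seq A]} -> Prop :=
| tens_rel0 : tens_rel 0
| tens_relZD c g h : tens_rel g -> tens_rel h -> tens_rel (c *: g + h)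
| tens_rel_gen s t c a b :
    tens_rel (<< s ++ (c *: a + b) :: t >>
              - (c *: << s ++ a :: t >> + << s ++ b :: t >>)).

Definition tens_relb : {pred {malg K[seq A]}} := fun g => `[< tens_rel g >].

Lemma tens_relb_submod : submod_closed tens_relb.
Proof.
split; first exact/asboolP/tens_rel0.
by move=> c g h /asboolP rg /asboolP rh; apply/asboolP; exact: tens_relZD.
Qed.

HB.instance Definition _ :=
  GRing.isSubmodClosed.Build K {malg K[seq A]} tens_relb tens_relb_submod.

Section FreeLift.
Context (W : lmodType K) (f : seq A -> W).

Definition flift (g : {malg K[seq A]}) : W := \sum_(s <- msupp g) g@_s *: f s.

Lemma fliftEw (g : {malg K[seq A]}) (d : {fset seq A}) :
  (msupp g `<=` d)%fset -> flift g = \sum_(s <- d) g@_s *: f s.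
Proof.
move=> le_gd; rewrite /flift; apply/esym.
rewrite (big_fset_incl _ le_gd) //= => s _ /mcoeff_outdom ->.
by rewrite scale0r.
Qed.

Lemma flift_linear : linear flift.
Proof.
move=> c g h.
pose d := (msupp g `|` msupp h `|` msupp (c *: g + h))%fset.
rewrite (@fliftEw g d) ?(@fliftEw h d) ?(@fliftEw (c *: g + h) d).
- rewrite scaler_sumr -big_split /=; apply: eq_bigr => s _.
  by rewrite mcoeffD mcoeffZ scalerDl scalerA.
- by rewrite /d fsubsetUr.
- by rewrite /d; apply/fsubsetP => x xh; rewrite !inE xh orbT.
- by rewrite /d; apply/fsubsetP => x xh; rewrite !inE xh.
Qed.

HB.instance Definition _ :=
  GRing.isLinear.Build K {malg K[seq A]} W *:%R flift flift_linear.

Lemma fliftU s : flift << s >> = f s.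
Proof.
rewrite /flift msuppU oner_eq0 big_seq_fset1 mcoeffUU.
by rewrite scale1r.
Qed.

Lemma flift_rel g : multilinear f -> tens_rel g -> flift g = 0.
Proof.
move=> fM; elim=> [|c {}g h _ g0 _ h0|s t c a b]; first exact: linear0.
  by rewrite linearP /= g0 h0 scaler0 addr0.
by rewrite linearB linearP /= !fliftU fM subrr.
Qed.

End FreeLift.

Definition tensalg : Type := Quotient.quot tens_relb.
HB.instance Definition _ := Choice.on tensalg.
HB.instance Definition _ := GRing.Zmodule.on tensalg.

Definition tpi (g : {malg K[seq A]}) : tensalg :=
  (\pi_(Quotient.quot tens_relb) g)%qT.

Definition trepr (x : tensalg) : {malg K[seq A]} :=
  generic_quotient.repr (x : Quotient.quot tens_relb).

Lemma treprK : cancel trepr tpi. Proof. exact: reprK. Qed.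

Lemma tpi_eq g h : (tpi g = tpi h) <-> tens_rel (g - h).
Proof.
split=> [/eqP|gh].
  by rewrite /tpi -Quotient.idealrBE => /asboolP.
by apply/eqP; rewrite /tpi -Quotient.idealrBE; apply/asboolP.
Qed.

Lemma tpiD g h : tpi (g + h) = tpi g + tpi h.
Proof. exact: (raddfD (\pi_(Quotient.quot tens_relb)%qT)). Qed.

Definition tscale (c : K) (x : tensalg) : tensalg := tpi (c *: trepr x).

Lemma tens_relZ c g : tens_rel g -> tens_rel (c *: g).
Proof. by move=> rg; rewrite -[c *: g]addr0; apply: tens_relZD => //; exact: tens_rel0. Qed.

Lemma trepr_rel g : tens_rel (trepr (tpi g) - g).
Proof. by apply/tpi_eq; rewrite treprK. Qed.

Lemma tpiZ c g : tpi (c *: g) = tscale c (tpi g).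
Proof.
apply/esym/tpi_eq; rewrite -scalerBr; apply: tens_relZ; exact: trepr_rel.
Qed.

Lemma tscaleA a b x : tscale a (tscale b x) = tscale (a * b) x.
Proof. by rewrite -[x]treprK -!tpiZ scalerA. Qed.

Lemma tscale1 : left_id 1 tscale.
Proof. by move=> x; rewrite -[x]treprK -tpiZ scale1r. Qed.

Lemma tscaleDr : right_distributive tscale +%R.
Proof.
move=> c x y; rewrite -[x]treprK -[y]treprK.
by rewrite -tpiD -!tpiZ -tpiD scalerDr.
Qed.

Lemma tscaleDl x : {morph tscale^~ x : a b / a + b}.
Proof. by move=> a b; rewrite -[x]treprK -!tpiZ -tpiD scalerDl. Qed.

HB.instance Definition _ := GRing.Zmodule_isLmodule.Build K tensalg
  tscaleA tscale1 tscaleDr tscaleDl.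

Lemma tpi_linear : linear tpi.
Proof. by move=> c g h; rewrite tpiD tpiZ. Qed.

HB.instance Definition _ :=
  GRing.isLinear.Build K {malg K[seq A]} tensalg *:%R tpi tpi_linear.

Definition ten (s : seq A) : tensalg := tpi << s >>.

Lemma ten_multilinear : multilinear ten.
Proof.
move=> s t c a b; rewrite /ten -linearP.
by apply/tpi_eq; exact: tens_rel_gen.
Qed.

(** The universal property of T(A): multilinear maps on words factor uniquely
    through [ten]. *)
Definition tlift (W : lmodType K) (f : seq A -> W) of multilinear f :
  tensalg -> W := fun x => flift f (trepr x).

Section Lift.
Context (W : lmodType K) (f : seq A -> W) (fM : multilinear f).

Lemma tlift_pi g : tlift fM (tpi g) = flift f g.
Proof.
apply/eqP; rewrite -subr_eq0 -linearB; apply/eqP.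
exact/(flift_rel fM)/trepr_rel.
Qed.

Lemma tlift_linear : linear (tlift fM).
Proof.
move=> c x y; rewrite -[x]treprK -[y]treprK -linearP !tlift_pi.
exact: linearP.
Qed.

HB.instance Definition _ :=
  GRing.isLinear.Build K tensalg W *:%R (tlift fM) tlift_linear.

Lemma tlift_ten s : tlift fM (ten s) = f s.
Proof. by rewrite tlift_pi fliftU. Qed.

End Lift.

Lemma tens_ext (W : lmodType K) (f g : {linear tensalg -> W}) :
  (forall s, f (ten s) = g (ten s)) -> f =1 g.
Proof.
move=> fg x; rewrite -[x]treprK (monalgE (trepr x)).
rewrite !raddf_sum; apply: eq_bigr => s _ /=.
have -> : << (trepr x)@_s *g s >> = (trepr x)@_s *: << s >> :> {malg K[seq A]}.
  by apply/malgP => t; rewrite mcoeffZ !mcoeffU mulrnAr mulr1.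
by rewrite !linearZ /= -/(ten s) fg.
Qed.

(** The linear maps T(A) (x) T(A) -> T(A) whose restriction to
    A^{(x) i} (x) A^{(x) j} = A^{(x) i+j} is the restriction of [g i j]. *)
Section Bilinear.
Context (g : nat -> nat -> {linear tensalg -> tensalg}).

Let bil_word (s t : seq A) : tensalg := g (size s) (size t) (ten (s ++ t)).

Lemma bil_word_multilinear s : multilinear (bil_word s).
Proof.
move=> u v c a b; rewrite /bil_word !size_cat /= !catA ten_multilinear.
exact: linearP.
Qed.

Lemma bil_left_multilinear y :
  multilinear (fun s => tlift (bil_word_multilinear s) y).
Proof.
move=> u v c a b.
pose W s : {linear tensalg -> tensalg} := tlift (bil_word_multilinear s).
pose F : {linear tensalg -> tensalg} := c \*: W (u ++ a :: v) \+ W (u ++ b :: v).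
apply: (tens_ext (f := W _) (g := F)) => t.
rewrite /F /W /= !tlift_ten /bil_word !size_cat /= -!catA /=.
by rewrite ten_multilinear linearP.
Qed.

Definition bil (x y : tensalg) : tensalg := tlift (bil_left_multilinear y) x.

Lemma bil_ten s t : bil (ten s) (ten t) = g (size s) (size t) (ten (s ++ t)).
Proof. by rewrite /bil !tlift_ten. Qed.

Lemma bil_linear_l y : linear (bil^~ y).
Proof. by move=> c x x'; rewrite /bil linearP. Qed.

Lemma bil_linear_r x : linear (bil x).
Proof.
move=> c y z.
pose L w : {linear tensalg -> tensalg} := tlift (bil_left_multilinear w).
pose F : {linear tensalg -> tensalg} := c \*: L y \+ L z.
apply: (tens_ext (f := L _) (g := F)) => s.
by rewrite /F /L /= !tlift_ten linearP.
Qed.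

HB.instance Definition _ :=
  bilinear_isBilinear.Build K tensalg tensalg tensalg *:%R *:%R bil
    (bil_linear_l, bil_linear_r).

End Bilinear.

Definition tcat : {bilinear tensalg -> tensalg -> tensalg} :=
  bil (fun _ _ => idfun).

(** The projection of T(A) onto its homogeneous component A^{(x) n}. *)
Section Degree.
Context (n : nat).

Let deg_word (s : seq A) : tensalg := if size s == n then ten s else 0.

Lemma deg_word_multilinear : multilinear deg_word.
Proof.
move=> s t c a b; rewrite /deg_word !size_cat /=; case: ifP => _.
  exact: ten_multilinear.
by rewrite scaler0 addr0.
Qed.

Definition tproj : {linear tensalg -> tensalg} := tlift deg_word_multilinear.

Lemma tproj_ten s : tproj (ten s) = if size s == n then ten s else 0.
Proof. exact: tlift_ten. Qed.

Lemma tprojK x : tproj (tproj x) = tproj x.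
Proof.
apply: (tens_ext (f := tproj \o tproj) (g := tproj)) => s /=.
by rewrite tproj_ten; case: ifP => sn; rewrite ?linear0 // tproj_ten sn.
Qed.

Definition homog : {pred tensalg} := fun x => tproj x == x.

Lemma homog_submod : submod_closed homog.
Proof.
split; first by rewrite unfold_in linear0.
move=> c x y; rewrite !unfold_in => /eqP xn /eqP yn.
by rewrite linearP xn yn.
Qed.

HB.instance Definition _ :=
  GRing.isSubmodClosed.Build K tensalg homog homog_submod.

(** A^{(x) n}, as a K-vector space of its own. *)
Record tpow := Tpow { tpow_val : tensalg; _ : tpow_val \in homog }.

HB.instance Definition _ := [isSub for tpow_val].
HB.instance Definition _ := [Choice of tpow by <:].
HB.instance Definition _ := [SubChoice_isSubLmodule of tpow by <:].

Lemma tproj_homog x : tproj x \in homog.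
Proof. by rewrite unfold_in tprojK. Qed.

Definition tcomp (x : tensalg) : tpow := Tpow (tproj_homog x).

Lemma tcomp_linear : linear tcomp.
Proof. by move=> c x y; apply: val_inj; rewrite linearP /= linearP. Qed.

HB.instance Definition _ :=
  GRing.isLinear.Build K tensalg tpow *:%R tcomp tcomp_linear.

End Degree.

(** Linear maps between tensor powers are handled as endomorphisms of T(A), of
    which only the values on the relevant component matter. *)
Definition text p q (f : {linear tpow p -> tpow q}) :
  {linear tensalg -> tensalg} := val \o f \o tcomp p.

(** f (x) g on A^{(x) n} = A^{(x) i} (x) A^{(x) n-i}, for all n >= i. *)
Section TensorMap.
Context (i : nat) (f g : {linear tensalg -> tensalg}).

Let map_word (s : seq A) : tensalg :=
  tcat (f (ten (take i s))) (g (ten (drop i s))).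

Lemma map_word_multilinear : multilinear map_word.
Proof.
move=> s t c a b; rewrite /map_word !take_cat !drop_cat.
case: ltnP => [_|si]; first by rewrite ten_multilinear linearP linearPr.
case: (i - size s)%N => [|k] /=.
  by rewrite (ten_multilinear [::]) linearP linearPr.
by rewrite ten_multilinear linearP linearPl.
Qed.

Definition tmap : {linear tensalg -> tensalg} := tlift map_word_multilinear.

Lemma tmap_ten s :
  tmap (ten s) = tcat (f (ten (take i s))) (g (ten (drop i s))).
Proof. exact: tlift_ten. Qed.

End TensorMap.

End FreeWords.

(** * Permutations and compositions

    The letters 1, ..., n are the elements 0, ..., n-1 of 'I_n.  Products in
    'S_n are composed left factor first, hence the [rev] below. *)
Section Perm.
Context (n : nat).

Lemma adj_subproof (k : 'I_n.-1) : (k.+1 < n)%N.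
Proof. by rewrite -ltn_predRL. Qed.

Definition adj (k : 'I_n.-1) : 'S_n :=
  tperm (widen_ord (leq_pred n) k) (Ordinal (adj_subproof k)).

(** s_{k_1} o ... o s_{k_l} *)
Definition adj_comp (ks : seq 'I_n.-1) : 'S_n :=
  (\prod_(k <- rev ks) adj k)%g.

Definition reduced_expr (w : 'S_n) : set (seq 'I_n.-1) :=
  [set ks | adj_comp ks = w /\
            forall ks', adj_comp ks' = w -> (size ks <= size ks')%N].

Definition ascents (w : 'S_n) : {set 'I_n * 'I_n} :=
  [set p : 'I_n * 'I_n |
    (p.2 == p.1.+1 :> nat) && ((w^-1)%g p.1 < (w^-1)%g p.2)%N].

Definition joined (S : {set 'I_n * 'I_n}) (k : nat) : bool :=
  [exists p in S, (p.1 == k :> nat) && (p.2 == k.+1 :> nat)].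

End Perm.

(** Lengths of the intervals cut out by b, whose k-th bit tells whether the
    k-th and k+1-st letters stay together; l is the length of the interval
    being read. *)
Fixpoint run_lengths (l : nat) (b : bitseq) : seq nat :=
  match b with
  | [::] => [:: l]
  | true :: b' => run_lengths l.+1 b'
  | false :: b' => l :: run_lengths 1 b'
  end.

Definition cp n (S : {set 'I_n * 'I_n}) : seq nat :=
  if n is 0 then [::] else run_lengths 1 [seq joined S k | k <- iota 0 n.-1].

Example run_lengths_ex :
  run_lengths 1 [:: true; true; false; false; false; true; false; true]
  = [:: 3; 1; 1; 2; 2].
Proof. by []. Qed.

Lemma chi_subproof i j (x : 'I_(i + j)) :
  ((if x < i then j + x else x - i) < i + j)%N.
Proof.
case: (ltnP x i) => [xi|ix]; first by rewrite addnC ltn_add2r.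
exact: leq_ltn_trans (leq_subr _ _) (ltn_ord x).
Qed.

Definition chi_fun i j (x : 'I_(i + j)) : 'I_(i + j) := Ordinal (chi_subproof x).

Lemma chi_inj i j : injective (@chi_fun i j).
Proof.
move=> x y /(congr1 val) /=; have := ltn_ord x; have := ltn_ord y.
case: (ltnP x i) => xi; case: (ltnP y i) => yi yn xn e; apply: val_inj => /=.
- exact: addnI e.
- by move: yn; rewrite -ltn_subLR // -e ltnNge leq_addr.
- by move: xn; rewrite -ltn_subLR // e ltnNge leq_addr.
- by rewrite -(subnK xi) e subnK.
Qed.

(** The first i letters jump over the last j ones. *)
Definition chi i j : 'S_(i + j) := perm (@chi_inj i j).

(** * Braided algebras and the quantum quasi-shuffle product *)
Section Braided.
Context (K : fieldType) (A : lmodType K).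
Context (m : {bilinear A -> A -> A}) (sigma : {linear tpow A 2 -> tpow A 2}).

Local Notation T := (tensalg A).
Local Notation tid := (idfun : {linear T -> T}).

Let mul_word (s : seq A) : T := if s is [:: a; b] then ten [:: m a b] else 0.

Lemma mul_word_multilinear : multilinear mul_word.
Proof.
case=> [|x [|y s]] [|z [|u t]] c a b /=; rewrite ?scaler0 ?addr0 //.
- by rewrite (linearPl m) (ten_multilinear [::] [::]).
- by rewrite (linearPr m) (ten_multilinear [::] [::]).
- by case: s => [|? ?] /=; rewrite scaler0 addr0.
- by case: s => [|? ?] /=; rewrite scaler0 addr0.
- by case: s => [|? ?] /=; rewrite scaler0 addr0.
Qed.

(** m : A (x) A -> A *)
Definition mulT : {linear T -> T} := tlift mul_word_multilinear.

(** id^{(x) k} (x) sigma (x) id^{(x) n-k-2} on A^{(x) n}, for all n >= k+2; the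
    index k is counted from 0, as for [adj]. *)
Definition sig (k : nat) : {linear T -> T} :=
  tmap k tid (tmap 2 (text sigma) tid).

Definition braiding : Prop :=
  bijective sigma /\
  forall x : tpow A 3, sig 0 (sig 1 (sig 0 (val x))) = sig 1 (sig 0 (sig 1 (val x))).

Record braided_algebra : Prop := BraidedAlgebra {
  ba_assoc : associative m;
  ba_braid : braiding;
  ba_mull : forall x : tpow A 3,
    tmap 1 tid mulT (sig 0 (sig 1 (val x))) = text sigma (tmap 2 mulT tid (val x));
  ba_mulr : forall x : tpow A 3,
    tmap 2 mulT tid (sig 1 (sig 0 (val x))) = text sigma (tmap 1 tid mulT (val x))
}.

Definition sig_comp (ks : seq nat) : {linear T -> T} :=
  foldr (fun k (f : {linear T -> T}) => sig k \o f : {linear T -> T}) tid ks.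

(** T_w, computed from some reduced expression of w *)
Definition Tperm n (w : 'S_n) : {linear T -> T} :=
  sig_comp [seq val k | k <- xget [::] (reduced_expr w)].

Definition beta (i j : nat) : {linear T -> T} :=
  if (i == 0%N) || (j == 0%N) then tid else Tperm (chi i j).

(** The restriction of the product to A^{(x) i} (x) A^{(x) j} = A^{(x) i+j};
    see [qshuffleSS] for the recursion. *)
Fixpoint qshuffle_at (i : nat) : nat -> {linear T -> T} :=
  if i isn't i'.+1 then fun=> tid else
  fix qsh (j : nat) : {linear T -> T} :=
    if j isn't j'.+1 then tid else
    tmap 1 tid (qshuffle_at i' j)
    \+ (tmap 1 tid (qsh j') \o tmap i.+1 (beta i 1) tid)
    \+ (tmap 2 mulT (qshuffle_at i' j') \o tmap 1 tid (tmap i (beta i' 1) tid)).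

Lemma qshuffle0 j : qshuffle_at 0 j = tid. Proof. by []. Qed.

Lemma qshuffleS0 i : qshuffle_at i.+1 0 = tid. Proof. by []. Qed.

Lemma qshuffleSS i j x :
  qshuffle_at i.+1 j.+1 x =
    tmap 1 tid (qshuffle_at i j.+1) x
    + tmap 1 tid (qshuffle_at i.+1 j) (tmap i.+2 (beta i.+1 1) tid x)
    + tmap 2 mulT (qshuffle_at i j) (tmap 1 tid (tmap i.+1 (beta i 1) tid) x).
Proof. by []. Qed.

Definition qshuffle : {bilinear T -> T -> T} := bil qshuffle_at.

(** m^k : A^{(x) k+1} -> A *)
Fixpoint mulpow (k : nat) : {linear T -> T} :=
  if k is k'.+1 then mulT \o tmap 1 tid (mulpow k') else tid.

Fixpoint mul_comp (I : seq nat) : {linear T -> T} :=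
  if I is i :: I' then tmap i (mulpow i.-1) (mul_comp I') else tid.

Definition TpermS n (w : 'S_n) (S : {set 'I_n * 'I_n}) : {linear T -> T} :=
  mul_comp (cp S) \o Tperm w.

Definition Tsum n (x : T) : T :=
  \sum_(p : 'S_n * {set 'I_n * 'I_n} | p.2 \subset ascents p.1)
    TpermS p.1 p.2 x.

Definition is_subalgebra (B : set T) : Prop :=
  [/\ B (ten [::]),
      forall (c : K) x y, B x -> B y -> B (c *: x + y)
    & forall x y, B x -> B y -> B (qshuffle x y)].

(** The subalgebra generated by A = A^{(x) 1} *)
Definition qsh_algebra : set T :=
  smallest is_subalgebra (range (fun a : A => ten [:: a])).

Definition Tsum_image (n : nat) : set T :=
  if n is 0 then range (fun c : K => c *: ten [::] : T)
  else range (fun x : tpow A n => Tsum n (val x)).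

End Braided.

(** The sum of a sequence of subspaces *)
Definition sum_subspaces (V : nmodType) (E : nat -> set V) : set V :=
  [set x | exists N (y : nat -> V),
     (forall n, E n (y n)) /\ x = \sum_(n < N) y n].

(* Main.v *)
Require Import Defs.
From HB Require Import structures.
From mathcomp Require Import all_boot all_order all_algebra all_fingroup.
From mathcomp Require Import sesquilinear.
From mathcomp Require Import boolp classical_sets.
From mathcomp Require Import finmap monalg.
From mathcomp Require Import zify.

Set Implicit Arguments.
Unset Strict Implicit.
Unset Printing Implicit Defensive.

Import GRing.Theory.
Local Open Scope ring_scope.

(** The product of a letter a with a tensor x is governed by one operator J,
    with J (a (x) x) = a * x, and by the equation

      J = id + (id (x) J) sigma_0 + m (x) id                  [letter_shuffleE]

    on tensors without constant term: the letter a stays in front, or jumps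
    over the first letter of x, or is multiplied with it.

    First assertion.  By induction on n, the product a_1 * (a_2 * ...) is the
    sum of J (a_1 (x) m_I (T_v (a_2 (x) ...))) over the permutations v of the
    other letters and the compositions I coming from sets of ascents of v.  The
    letter a_1 jumps over some blocks of I, and then stays alone or joins the
    next block.  As sigma is compatible with m, jumping over a block is the
    same as jumping over its letters before they are multiplied, so a_1 is
    moved by some s_{p-1} ... s_0, where p is the position at which a block of I
    starts or the end of the word.  The permutation w = s_{p-1} ... s_0 (1 x v)
    sends the first letter to p, and every w arises once in this way.  Its
    ascents are those of v, except that the pair (p-1, p), which the new letter
    separates, is replaced by a non-ascent and an ascent.  That matches
    the two facts that p starts a block and that a_1 may or may not join that
    block.  The sum of the m_I over all sets of ascents is therefore kept as one
    operator [ascent_mul], a product over the bits of the ascent sequence, and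
    [letter_shuffle_ascent] is the resulting identity.

    The positions p chosen at the successive steps form the Lehmer code of w,
    and the words s_{p-1} ... s_0 a reduced expression of w.  That T_w can be
    computed from this expression rests on [act_code_swap]: multiplying the
    normal form by an s_k which increases the length gives, through the braid
    relations, the normal form of the product.

    Second assertion.  By the first one, the n-th summand is spanned by the
    products a_1 * (a_2 * (... * a_n)), so only the stability of the sum under
    the product is at stake.  It follows from the associativity
    (a * x) * y = a * (x * y) for a letter a [qsh_letter_assoc].  Here one uses
    the recursion on the first letter b of y, in which b has to be pushed
    through J x; by the braid relation and the compatibility of sigma
    with m, this is the same as pushing it through x first
    [push_front_letter]. *)

(** * Lehmer codes and reduced words *)

Section LehmerCodes.
Local Open Scope nat_scope.

Definition swap (k x : nat) : nat :=
  if x == k then k.+1 else if x == k.+1 then k else x.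

(** The permutation w with Lehmer code [p :: c] sends 0 to p, and its other
    letters are permuted according to [c] among the remaining values. *)
Fixpoint code_fun (c : seq nat) (x : nat) : nat :=
  match c, x with
  | [::], _ => x
  | p :: _, 0 => p
  | p :: c', x'.+1 => bump p (code_fun c' x')
  end.

Fixpoint code_inv (c : seq nat) (y : nat) : nat :=
  if c is p :: c' then
    if y == p then 0 else (code_inv c' (unbump p y)).+1
  else y.

(** The letter 0 moves up to position p after the others have been permuted. *)
Fixpoint code_word (c : seq nat) : seq nat :=
  if c is p :: c' then rev (iota 0 p) ++ map succn (code_word c') else [::].

(** The code of s_k w: when k and k+1 are not values of the first letter, s_k
    exchanges two values of the others, whose ranks are one less above p. *)
Fixpoint code_swap (k : nat) (c : seq nat) : seq nat :=
  if c is p :: c' then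
    if k == p then p.+1 :: c'
    else if k.+1 == p then k :: c'
    else p :: code_swap (if k < p then k else k.-1) c'
  else [::].

(** The ascents k are the ones for which s_k w is longer than w. *)
Definition code_asc (c : seq nat) (k : nat) : bool := code_inv c k < code_inv c k.+1.

Fixpoint code_wf (c : seq nat) : bool :=
  if c is p :: c' then (p <= size c') && code_wf c' else true.

Lemma code_funK c : cancel (code_fun c) (code_inv c).
Proof.
elim: c => [|p c IHc] [|x] //=; first by rewrite eqxx.
by rewrite eq_sym (negPf (neq_bump _ _)) bumpK IHc.
Qed.

Lemma code_asc_cons p c k :
  code_asc (p :: c) k =
    if k == p then true else if k.+1 == p then false
    else code_asc c (if k < p then k else k.-1).
Proof.
rewrite /code_asc /=.
have [->|kp] := eqVneq k p; first by rewrite gtn_eqF.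
have [//|k1p] := eqVneq k.+1 p.
have -> : unbump p k = if k < p then k else k.-1.
  by rewrite /unbump; case: ltngtP kp; lia.
have -> : unbump p k.+1 = (if k < p then k else k.-1).+1.
  by rewrite /unbump; case: (ltngtP k p) kp; case: (ltngtP p k.+1) k1p; lia.
by rewrite ltnS.
Qed.

Lemma size_code_swap k c : size (code_swap k c) = size c.
Proof.
by elim: c k => //= p c IHc k; case: ifP => // _; case: ifP => // _; rewrite /= IHc.
Qed.

Lemma code_swap_index p k n : p <= n -> k.+1 < n.+1 -> k != p -> k.+1 != p ->
  (if k < p then k else k.-1).+1 < n.
Proof. by case: (ltnP k p); lia. Qed.

Lemma code_wf_swap k c : code_wf c -> k.+1 < size c -> code_wf (code_swap k c).
Proof.
elim: c k => //= p c IHc k /andP[pc wf] kc.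
have [<-|kp] := eqVneq k p; first by rewrite /= wf; lia.
have [k1p|k1p] := eqVneq k.+1 p; first by rewrite /= wf; lia.
by rewrite /= size_code_swap pc IHc // code_swap_index.
Qed.

Lemma code_fun_swap k c x :
  code_wf c -> k.+1 < size c -> code_fun (code_swap k c) x = swap k (code_fun c x).
Proof.
elim: c k x => //= p c IHc k x /andP[pc wf] kc.
have [<-|kp] := eqVneq k p.
  case: x => [|x] /=; first by rewrite /swap eqxx.
  by rewrite /swap /bump; do !case: ifP; lia.
have [<-|k1p] := eqVneq k.+1 p.
  case: x => [|x] /=; first by rewrite /swap /=; do !case: ifP; lia.
  by rewrite /swap /bump; do !case: ifP; lia.
case: x => [|x] /=.
  by rewrite /swap; do !case: ifP; lia.
rewrite IHc ?code_swap_index //.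
by rewrite /swap /bump; case: (ltnP k p); do !case: ifP; lia.
Qed.

(** The entries of a Lehmer code count inversions, so their sum is the length
    of the permutation. *)
Lemma sumn_code_swap k c : code_wf c -> k.+1 < size c ->
  if code_asc c k then sumn (code_swap k c) = (sumn c).+1
  else (sumn (code_swap k c)).+1 = sumn c.
Proof.
elim: c k => //= p c IHc k /andP[pc wf] kc; rewrite code_asc_cons.
have [<-|kp] := eqVneq k p; first by [].
have [<-|k1p] := eqVneq k.+1 p; first by [].
have := IHc _ wf (code_swap_index pc kc kp k1p).
by case: (code_asc _ _) => /= IHk; rewrite -?addnS -IHk ?addnS.
Qed.

Lemma code_fun_nseq0 n x : code_fun (nseq n 0) x = x.
Proof. by elim: n x => [|n IHn] [|x] //=; rewrite IHn /bump add1n. Qed.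

Lemma code_wf_nseq0 n : code_wf (nseq n 0).
Proof. by elim: n. Qed.

Lemma code_word_nseq0 n : code_word (nseq n 0) = [::].
Proof. by elim: n => //= n ->. Qed.

Lemma size_code_word c : size (code_word c) = sumn c.
Proof. by elim: c => //= p c IHc; rewrite size_cat size_rev size_iota size_map IHc. Qed.

Lemma code_fun_inj c d :
  size c = size d -> (forall x, x < size c -> code_fun c x = code_fun d x) -> c = d.
Proof.
elim: c d => [|p c IHc] [|q d] //= [cd] e.
have pq : p = q by exact: (e 0).
rewrite -pq in e *; congr (_ :: _); apply: IHc => // x xc.
exact/(can_inj (bumpK p))/(e x.+1).
Qed.

Lemma code_word_lt c : code_wf c -> all (gtn (size c).-1) (code_word c).
Proof.
elim: c => //= p c IHc /andP[pc /IHc {}IHc].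
rewrite all_cat all_rev all_map; apply/andP; split.
  by apply/allP => x; rewrite mem_iota /=; lia.
by apply: sub_all IHc => x /=; lia.
Qed.

Section Action.
Context (U : Type).

Record braid_action (act : nat -> U -> U) : Prop := BraidAction {
  act_comm : forall k l x, k.+1 < l -> act k (act l x) = act l (act k x);
  act_braid : forall k x, act k (act k.+1 (act k x)) = act k.+1 (act k (act k.+1 x))
}.

Definition act_word (act : nat -> U -> U) (ks : seq nat) (x : U) : U :=
  foldr act x ks.

Lemma act_word_cat act ks ls x :
  act_word act (ks ++ ls) x = act_word act ks (act_word act ls x).
Proof. exact: foldr_cat. Qed.

Lemma act_word_map act h ks x :
  act_word act (map h ks) x = act_word (act \o h) ks x.
Proof. by elim: ks => //= k ks ->. Qed.

Lemma braid_action_shift act : braid_action act -> braid_action (act \o succn).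
Proof. by case=> C B; split=> [k l x kl|k x]; [apply: C | apply: B]. Qed.

Lemma rev_iotaS p : rev (iota 0 p.+1) = p :: rev (iota 0 p).
Proof. by rewrite -{1}addn1 iotaD rev_cat. Qed.

Lemma act_rev_iota_comm act p k x : braid_action act -> p < k ->
  act k (act_word act (rev (iota 0 p)) x) = act_word act (rev (iota 0 p)) (act k x).
Proof.
move=> [C _]; elim: p => // p IHp pk.
by rewrite rev_iotaS /= -C // IHp // ltnW.
Qed.

(** A single braid relation, at the letters k and k+1 of the word
    s_{p-1} ... s_0, turns s_k on its left into s_{k+1} on its right. *)
Lemma act_rev_iota act p k x : braid_action act -> k.+1 < p ->
  act k (act_word act (rev (iota 0 p)) x) = act_word act (rev (iota 0 p)) (act k.+1 x).
Proof.
move=> actB; have [C B] := actB; elim: p => // p IHp.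
rewrite ltnS leq_eqVlt => /orP[/eqP <-|kp].
  by rewrite !rev_iotaS /= B -act_rev_iota_comm.
by rewrite rev_iotaS /= C // IHp.
Qed.

(** If k = p, the letter s_k prolongs s_{p-1} ... s_0; if k + 1 = p, there is no
    ascent at k.  Otherwise s_k passes through s_{p-1} ... s_0 and acts on the
    other letters, to which the induction hypothesis applies for the shifted
    action. *)
Lemma act_code_swap act k c x :
  braid_action act -> code_wf c -> k.+1 < size c -> code_asc c k ->
  act_word act (code_word (code_swap k c)) x = act k (act_word act (code_word c) x).
Proof.
elim: c act k x => //= p c IHc act k x actB /andP[pc wf] kc; rewrite code_asc_cons.
have [<- _|kp] := eqVneq k p.
  by rewrite [code_word (k.+1 :: c)]/(rev (iota 0 k.+1) ++ _) rev_iotaS.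
have [//|k1p] := eqVneq k.+1 p => asc_k.
rewrite /= !act_word_cat !act_word_map.
rewrite IHc ?code_swap_index //=; last exact: braid_action_shift.
case: (ltnP k p) kp k1p => kp kp' k1p.
  by rewrite act_rev_iota //; lia.
rewrite act_rev_iota_comm //; last by lia.
by rewrite prednK //; lia.
Qed.

(** Matsumoto's theorem for the symmetric group.  If the length of a word is the
    length of its permutation, then each letter increases the length, so that
    [act_code_swap] brings the word into normal form letter by letter. *)
Lemma act_reduced act n ks x (c := foldr code_swap (nseq n 0) ks) :
    braid_action act -> all (gtn n.-1) ks ->
  [/\ code_wf c, size c = n, sumn c <= size ks &
      sumn c = size ks -> act_word act ks x = act_word act (code_word c) x].
Proof.
move=> actB; rewrite {}/c; elim: ks => [|k ks IHks] /=.
  by rewrite size_nseq code_word_nseq0 sumn_nseq code_wf_nseq0.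
move=> /andP[kn /IHks [wf cn le_c act_c]]; rewrite size_code_swap.
have kc : k.+1 < size (foldr code_swap (nseq n 0) ks) by rewrite cn; lia.
have wf' := code_wf_swap wf kc.
have := sumn_code_swap wf kc; case: ifP => asc_k sum_k; last by split; lia.
split=> // [|sum_eq]; first by rewrite sum_k.
by rewrite act_code_swap // act_c //; lia.
Qed.

End Action.

Lemma swap_braid : braid_action swap.
Proof.
split=> [k l x kl|k x]; rewrite /swap; last by do !case: ifP; lia.
by do !case: ifP; lia.
Qed.

Lemma code_fun_word ks n x : all (gtn n.-1) ks ->
  code_fun (foldr code_swap (nseq n 0) ks) x = act_word swap ks x.
Proof.
elim: ks => [|k ks IHks] /=; first by rewrite code_fun_nseq0.
move=> /andP[kn kks]; rewrite code_fun_swap ?IHks //.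
  by have [] := act_reduced x swap_braid kks.
by have [_ -> _ _] := act_reduced x swap_braid kks; lia.
Qed.

Lemma swap_word_shift ks x :
  act_word swap (map succn ks) x.+1 = (act_word swap ks x).+1.
Proof.
elim: ks => //= k ks ->.
by rewrite /swap !eqSS; do !case: ifP.
Qed.

Lemma swap_word_shift0 ks : act_word swap (map succn ks) 0 = 0.
Proof. by elim: ks => //= k ks ->. Qed.

Lemma swap_rev_iota p x :
  act_word swap (rev (iota 0 p)) x = if x is x'.+1 then bump p x' else p.
Proof.
elim: p => [|p IHp]; first by case: x.
rewrite rev_iotaS /= IHp /swap /bump; case: x {IHp} => [|x]; do !case: ifP; lia.
Qed.

Lemma swap_code_word c x : act_word swap (code_word c) x = code_fun c x.
Proof.
elim: c x => //= p c IHc x; rewrite act_word_cat swap_rev_iota.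
by case: x => [|x]; rewrite ?swap_word_shift0 // swap_word_shift IHc.
Qed.

(** The ascents of a permutation with first value p whose other letters have
    the ascents [e]: the value p separates the neighbours p - 1 and p of the
    others, and it comes first, so (p-1, p) is not an ascent and (p, p+1) is. *)
Fixpoint insert_ascent (p : nat) (e : bitseq) : bitseq :=
  match p, e with
  | 0, _ => true :: e
  | _.+1, [::] => [:: false]
  | p'.+1, b :: e' => (b && (p' != 0)) :: insert_ascent p' e'
  end.

Definition ascent_bits (c : seq nat) : bitseq :=
  [seq code_asc c k | k <- iota 0 (size c).-1].

Lemma size_insert_ascent p e : size (insert_ascent p e) = (size e).+1.
Proof. by elim: p e => [|p IHp] [|b e] //=; rewrite IHp. Qed.

Lemma nth_insert_ascent p e k : k <= size e ->
  nth false (insert_ascent p e) k =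
    if k == p then true else if k.+1 == p then false
    else nth false e (if k < p then k else k.-1).
Proof.
elim: p e k => [|p IHp] [|b e] [|k] //=; rewrite ?eqSS.
- by case: p {IHp}.
- by case: p {IHp} => [|p] _ /=; rewrite ?andbF ?andbT.
move=> ke; rewrite IHp // ltnS.
case: eqVneq => // kp; case: eqVneq => // k1p.
case: (ltnP k p) => // pk; case: k kp k1p pk {ke} => //=; case: p {IHp} => //.
Qed.

Lemma ascent_bits_cons p c : p <= size c -> 0 < size c ->
  ascent_bits (p :: c) = insert_ascent p (ascent_bits c).
Proof.
move=> pc c0; apply: (@eq_from_nth _ false) => [|k].
  by rewrite size_insert_ascent !size_map !size_iota /= prednK.
rewrite size_map size_iota /= => kc.
rewrite nth_insert_ascent; last by rewrite size_map size_iota; lia.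
rewrite (nth_map 0) ?size_iota // nth_iota // code_asc_cons add0n.
case: eqVneq => // kp; case: eqVneq => // k1p.
have kc' : (if k < p then k else k.-1) < (size c).-1.
  by rewrite -ltnS prednK // code_swap_index.
by rewrite (nth_map 0) ?size_iota // nth_iota.
Qed.

End LehmerCodes.

(** * Permutations and their codes *)

Section PermCode.
Local Open Scope group_scope.

Lemma lift_perm0_inj n :
  injective (fun pw : 'I_n.+1 * 'S_n => lift_perm ord0 pw.1 pw.2).
Proof.
move=> [p w] [q v] /= e.
have pq : p = q by rewrite -(lift_perm_id ord0 p w) e lift_perm_id.
congr (_, _) => //; apply/permP => i; apply: (@lift_inj _ p).
by rewrite -(lift_perm_lift ord0) [in RHS]pq e lift_perm_lift.
Qed.

Lemma lift_perm0_bij n :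
  bijective (fun pw : 'I_n.+1 * 'S_n => lift_perm ord0 pw.1 pw.2).
Proof.
apply: inj_card_bij; first exact: lift_perm0_inj.
by rewrite card_prod !card_Sn card_ord factS.
Qed.

Definition behead_perm n (w : 'S_n.+1) : 'S_n :=
  odflt 1 [pick v | lift_perm ord0 (w ord0) v == w].

Lemma behead_permK n (w : 'S_n.+1) : lift_perm ord0 (w ord0) (behead_perm w) = w.
Proof.
rewrite /behead_perm; case: pickP => [v /eqP //|no_v].
have [g _ gK] := lift_perm0_bij n; have /= := gK w.
case: (g w) => p v /= wE; have := no_v v.
by rewrite -wE lift_perm_id eqxx.
Qed.

Lemma behead_perm_lift n p (v : 'S_n) : behead_perm (lift_perm ord0 p v) = v.
Proof.
have := behead_permK (lift_perm ord0 p v); rewrite lift_perm_id => e.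
by have /= := @lift_perm0_inj _ (p, _) (p, _) e; case.
Qed.

Fixpoint perm_code n : 'S_n -> seq nat :=
  if n is n'.+1 then fun w => val (w ord0) :: perm_code (behead_perm w)
  else fun=> [::].

Lemma perm_code_lift n p (v : 'S_n) :
  perm_code (lift_perm ord0 p v) = val p :: perm_code v.
Proof. by rewrite /= lift_perm_id behead_perm_lift. Qed.

Lemma size_perm_code n (w : 'S_n) : size (perm_code w) = n.
Proof. by elim: n w => //= n IHn w; rewrite IHn. Qed.

Lemma perm_code_wf n (w : 'S_n) : code_wf (perm_code w).
Proof.
by elim: n w => //= n IHn w; rewrite IHn size_perm_code -ltnS ltn_ord.
Qed.

Lemma perm_codeE n (w : 'S_n) i : code_fun (perm_code w) (val i) = val (w i).
Proof.
elim: n w i => [|n IHn] w i; first by case: i.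
rewrite -(behead_permK w) perm_code_lift.
case: (unliftP ord0 i) => [j ->|->]; last by rewrite lift_perm_id.
by rewrite lift_perm_lift /= IHn.
Qed.

Lemma perm_code_inv n (w : 'S_n) i : code_inv (perm_code w) (val i) = val (w^-1 i).
Proof. by rewrite -{1}(permKV w i) -perm_codeE code_funK. Qed.

Lemma perm_codeP n (w : 'S_n) c : size c = n ->
  (forall i : 'I_n, code_fun c (val i) = val (w i)) -> perm_code w = c.
Proof.
move=> cn cw; apply: code_fun_inj; rewrite size_perm_code // => x xn.
by rewrite (perm_codeE w (Ordinal xn)) -cw.
Qed.

Lemma val_adj n (k : 'I_n.-1) (i : 'I_n) : val (adj k i) = swap (val k) (val i).
Proof.
rewrite /adj /swap; case: tpermP => [->|->|ik ik1] /=.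
- by rewrite eqxx.
- by rewrite gtn_eqF // eqxx.
case: eqP => [e|_]; first by case: ik; apply: val_inj.
by case: eqP => [e|//]; case: ik1; apply: val_inj.
Qed.

Lemma val_adj_comp n (ks : seq 'I_n.-1) (i : 'I_n) :
  val (adj_comp ks i) = act_word swap (map val ks) (val i).
Proof.
elim: ks => [|k ks IHks] /=; first by rewrite /adj_comp big_nil perm1.
by rewrite -IHks -val_adj /adj_comp rev_cons big_rcons /= permM.
Qed.

Lemma all_map_ord n (ks : seq 'I_n) : all (gtn n) (map val ks).
Proof. by apply/allP => _ /mapP[k _ ->] /=. Qed.

Lemma seq_ordP n (s : seq nat) : all (gtn n) s -> exists ks : seq 'I_n, map val ks = s.
Proof.
elim: s => [|k s IHs] /=; first by exists [::].
by case/andP=> kn /IHs[ks <-]; exists (Ordinal kn :: ks).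
Qed.

Lemma perm_code_adj_comp n (ks : seq 'I_n.-1) :
  perm_code (adj_comp ks) = foldr code_swap (nseq n 0%N) (map val ks).
Proof.
apply: perm_codeP => [|i].
  by have [] := act_reduced 0 swap_braid (all_map_ord ks).
by rewrite val_adj_comp code_fun_word ?all_map_ord.
Qed.

Lemma code_word_expr n (w : 'S_n) : exists2 ks : seq 'I_n.-1,
  map val ks = code_word (perm_code w) & adj_comp ks = w.
Proof.
have [ks ksE] : exists ks : seq 'I_n.-1, map val ks = code_word (perm_code w).
  by apply: seq_ordP; rewrite -{1}(size_perm_code w) code_word_lt ?perm_code_wf.
exists ks => //; apply/permP => i; apply: val_inj.
by rewrite val_adj_comp ksE swap_code_word perm_codeE.
Qed.

Lemma leq_sumn_perm_code n (ks : seq 'I_n.-1) :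
  (sumn (perm_code (adj_comp ks)) <= size ks)%N.
Proof.
rewrite perm_code_adj_comp.
by have [_ _] := act_reduced 0 swap_braid (all_map_ord ks); rewrite size_map.
Qed.

Lemma size_reduced_expr n (w : 'S_n) (ks : seq 'I_n.-1) :
  reduced_expr w ks -> size ks = sumn (perm_code w).
Proof.
move=> [ksw ks_min]; apply/eqP; rewrite eqn_leq -{2}ksw leq_sumn_perm_code andbT.
have [ls lsE lsw] := code_word_expr w.
by rewrite -size_code_word -lsE size_map ks_min.
Qed.

Lemma reduced_expr_ex n (w : 'S_n) : exists ks, reduced_expr w ks.
Proof.
have [ls lsE lsw] := code_word_expr w; exists ls; split=> // ks ksw.
by rewrite -(size_map val ls) lsE size_code_word -ksw leq_sumn_perm_code.
Qed.

Lemma act_reduced_expr n (w : 'S_n) U (act : nat -> U -> U) x : braid_action act ->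
  act_word act [seq val k | k <- xget [::] (reduced_expr w)] x
  = act_word act (code_word (perm_code w)) x.
Proof.
move=> actB; case: xgetP => [ks _ ks_red|no_ks]; last first.
  by have [ks /no_ks] := reduced_expr_ex w.
have [_ _ _] := act_reduced x actB (all_map_ord ks).
have [ksw _] := ks_red.
by rewrite -perm_code_adj_comp ksw size_map -(size_reduced_expr ks_red); apply.
Qed.

Lemma perm_code_chi i : perm_code (chi i 1) = rcons (nseq i 1%N) 0%N.
Proof.
apply: perm_codeP => [|x]; first by rewrite size_rcons size_nseq addn1.
rewrite permE /=; move: (val x) (ltn_ord x) => {x} x; rewrite addn1.
elim: i x => [|i IHi] [|x] //=; rewrite ltnS => xi.
by rewrite IHi // ltnS; case: ltnP; rewrite /bump ?subSS; lia.
Qed.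

Lemma code_word_chi i : code_word (perm_code (chi i 1)) = iota 0 i.
Proof.
rewrite perm_code_chi; elim: i => //= i ->; rewrite /rev /=.
by rewrite (iotaDl 1 0).
Qed.

End PermCode.

Arguments perm_code : simpl never.
Arguments ascent_bits : simpl never.

(** * Sets of ascents as bit sequences *)

Section AscentBits.
Local Open Scope nat_scope.

Fixpoint sub_bits (e : bitseq) : seq bitseq :=
  if e is b :: e' then
    [seq false :: u | u <- sub_bits e'] ++
    (if b then [seq true :: u | u <- sub_bits e'] else [::])
  else [:: [::]].

Lemma mem_map_cons b (u : bitseq) c s :
  (b :: u \in [seq c :: v | v <- s]) = (b == c) && (u \in s).
Proof.
have [->|bc] := eqVneq b c; first by rewrite mem_map // => ? ? [].
by apply/mapP => -[v _ [/eqP]]; rewrite (negPf bc).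
Qed.

Lemma mem_sub_bits u e :
  (u \in sub_bits e) = (size u == size e) && all2 implb u e.
Proof.
elim: e u => [|b e IHe] [|c u] //=.
- by apply/negP; rewrite mem_cat => /orP[/mapP[]|]; case: b => // /mapP[].
- rewrite mem_cat mem_map_cons IHe eqSS.
  by case: b c => -[]; rewrite ?mem_map_cons ?IHe ?andbF ?orbF.
Qed.

Lemma sub_bits_uniq e : uniq (sub_bits e).
Proof.
elim: e => //= b e IHe; rewrite cat_uniq map_inj_uniq ?IHe => [|? ? [] //].
case: b => //=; rewrite map_inj_uniq ?IHe => [|? ? [] //]; rewrite andbT.
by apply/hasPn => _ /mapP[u _ ->]; apply/negP => /mapP[].
Qed.

Lemma mem_sub_bits_nth u e : size u = size e ->
  (u \in sub_bits e) <-> (forall k, nth false u k -> nth false e k).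
Proof.
move=> ue; rewrite mem_sub_bits ue eqxx /=.
elim: u e ue => [|b u IHu] [|c e] //= [ue].
split=> [/andP[/implyP bc /(IHu _ ue) h] [|k]|h]; [exact: bc|exact: h|].
apply/andP; split; first exact/implyP/(h 0).
by apply/(IHu _ ue) => k; apply: (h k.+1).
Qed.

Section AscentSets.
Context (n : nat) (w : 'S_n).

Definition joined_bits (S : {set 'I_n * 'I_n}) : bitseq :=
  [seq joined S k | k <- iota 0 n.-1].

Let asc := ascent_bits (perm_code w).

Lemma mem_ascents (i j : 'I_n) :
  ((i, j) \in ascents w) = (j == i.+1 :> nat) && nth false asc i.
Proof.
rewrite inE /=; have [ji|//] := eqVneq (val j) i.+1.
have in1 : i < n.-1 by have := ltn_ord j; rewrite ji; lia.
rewrite /asc /ascent_bits (nth_map 0) ?size_iota ?size_perm_code // nth_iota // add0n.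
by rewrite /code_asc !perm_code_inv -ji perm_code_inv.
Qed.

Lemma nth_joined_bits (S : {set 'I_n * 'I_n}) (i j : 'I_n) :
  S \subset ascents w -> ((i, j) \in S) = (j == i.+1 :> nat) && nth false (joined_bits S) i.
Proof.
move=> /fintype.subsetP sub; have [ji|ji] := eqVneq (val j) i.+1; last first.
  by apply/negP => /sub; rewrite mem_ascents (negPf ji).
have in1 : i < n.-1 by have := ltn_ord j; rewrite ji; lia.
rewrite (nth_map 0) ?size_iota // nth_iota // add0n.
apply/idP/existsP => [ijS|[[i' j'] /=]]; first by exists (i, j); rewrite ijS /= ji !eqxx.
case/and3P=> ijS /eqP/val_inj i'E /eqP j'E.
have j'j : j' = j by apply: val_inj; rewrite /= j'E ji.
by rewrite -i'E -j'j.
Qed.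

Lemma joined_bits_sub (S : {set 'I_n * 'I_n}) :
  S \subset ascents w -> joined_bits S \in sub_bits asc.
Proof.
move=> sub; apply/mem_sub_bits_nth => [|k].
  by rewrite !size_map !size_iota size_perm_code.
have [kn|nk] := ltnP k n.-1; last first.
  by rewrite nth_default // size_map size_iota.
rewrite (nth_map 0) ?size_iota // nth_iota //.
case/existsP=> -[i j] /= /and3P[/(fintype.subsetP sub)]; rewrite mem_ascents.
by case/andP=> _ h /eqP; rewrite add0n => <-.
Qed.

Lemma joined_bits_inj :
  {in [pred S : {set 'I_n * 'I_n} | S \subset ascents w] &, injective joined_bits}.
Proof.
move=> S S' subS subS' e; apply/setP => -[i j].
by rewrite !nth_joined_bits // e.
Qed.

Lemma joined_bits_surj u : u \in sub_bits asc ->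
  exists2 S : {set 'I_n * 'I_n}, S \subset ascents w & joined_bits S = u.
Proof.
move=> u_sub; have size_u : size u = size asc.
  by move: u_sub; rewrite mem_sub_bits => /andP[/eqP].
have size_asc : size asc = n.-1 by rewrite size_map size_iota size_perm_code.
pose S := [set p in ascents w | nth false u (val p.1)].
have subS : S \subset ascents w by apply/fintype.subsetP => p; rewrite inE => /andP[].
exists S => //; apply: (@eq_from_nth _ false) => [|k].
  by rewrite size_u size_asc size_map size_iota.
rewrite size_map size_iota => kn.
have i_lt : k < n by lia.
have j_lt : k.+1 < n by lia.
have := nth_joined_bits (Ordinal i_lt) (Ordinal j_lt) subS; rewrite /= eqxx /= => <-.
rewrite inE mem_ascents /= eqxx /=; apply/andb_idl.
exact: ((mem_sub_bits_nth size_u).1 u_sub).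
Qed.

(** A set of ascents is determined by the bits telling which neighbours it
    joins, and these are the sequences below the ascent bits. *)
Lemma sum_ascent_sets (V : zmodType) (G : bitseq -> V) :
  (\sum_(S : {set 'I_n * 'I_n} | S \subset ascents w) G (joined_bits S)
   = \sum_(u <- sub_bits asc) G u)%R.
Proof.
rewrite -big_filter -(big_map joined_bits xpredT); apply: perm_big.
apply: uniq_perm; last 1 first.
- move=> u; apply/mapP/idP => [[S]|/joined_bits_surj[S subS <-]].
    by rewrite mem_filter => /andP[/joined_bits_sub subS _ ->].
  by exists S; rewrite // mem_filter subS mem_index_enum.
- rewrite map_inj_in_uniq ?filter_uniq ?index_enum_uniq // => S S'.
  by rewrite !mem_filter => /andP[subS _] /andP[subS' _]; apply: joined_bits_inj.
exact: sub_bits_uniq.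
Qed.

End AscentSets.

End AscentBits.

(** * Operators on words *)

(** [T] stands for the tensor algebra, of which only the following is used: its
    elements are combinations of words [ten s], and its structure maps have
    prescribed values on words.  Each of them is introduced together with the
    equations that it satisfies. *)
Section TensorCalculus.
Context (K : fieldType) (A T : lmodType K).
Implicit Types (f g : {linear T -> T}) (x y z : T) (s t u : seq A) (a b : A).
Local Notation tid := (idfun : {linear T -> T}).

Context (ten : seq A -> T).
Context (tens_ext : forall f g, (forall s, f (ten s) = g (ten s)) -> f =1 g).

Context (tcat : {bilinear T -> T -> T}).
Local Infix "⊙" := tcat (at level 40, left associativity).
Context (tcat_ten : forall s t, ten s ⊙ ten t = ten (s ++ t)).

Context (tproj : nat -> {linear T -> T}).
Context (tproj_ten : forall n s,
  tproj n (ten s) = if size s == n then ten s else 0).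

Context (tmap : nat -> {linear T -> T} -> {linear T -> T} -> {linear T -> T}).
Context (tmap_ten : forall i f g s,
  tmap i f g (ten s) = f (ten (take i s)) ⊙ g (ten (drop i s))).

Definition homogeneous n : {pred T} := fun x => tproj n x == x.

Definition tcatl y : T -> T := fun x => tcat x y.

Lemma tcatl_linear y : linear (tcatl y).
Proof. by move=> c x z; rewrite /tcatl linearPl. Qed.

HB.instance Definition _ y :=
  GRing.isLinear.Build K T T *:%R (tcatl y) (tcatl_linear y).

Definition tcatr x : T -> T := fun y => tcat x y.

Lemma tcatr_linear x : linear (tcatr x).
Proof. by move=> c y z; rewrite /tcatr linearPr. Qed.

HB.instance Definition _ x :=
  GRing.isLinear.Build K T T *:%R (tcatr x) (tcatr_linear x).

Lemma tcat1x x : ten [::] ⊙ x = x.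
Proof.
apply: (tens_ext (f := tcatr (ten [::])) (g := tid)) => s.
by rewrite /= /tcatr tcat_ten.
Qed.

Lemma tcatA x y z : x ⊙ (y ⊙ z) = x ⊙ y ⊙ z.
Proof.
apply: (tens_ext (f := tcatl (y ⊙ z)) (g := tcatl z \o tcatl y)) => s.
rewrite /= /tcatl.
apply: (tens_ext (f := tcatr (ten s) \o tcatl z)
                 (g := tcatl z \o tcatr (ten s))) => t.
rewrite /= /tcatl /tcatr.
apply: (tens_ext (f := tcatr (ten s) \o tcatr (ten t))
                 (g := tcatr (ten s ⊙ ten t))) => u.
by rewrite /= /tcatr !tcat_ten catA.
Qed.

Lemma homog0 n : 0 \in homogeneous n.
Proof. by rewrite unfold_in linear0. Qed.

Lemma ten_homog s : ten s \in homogeneous (size s).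
Proof. by rewrite unfold_in tproj_ten eqxx. Qed.

Lemma homog_ext n f g :
    (forall s, size s = n -> f (ten s) = g (ten s)) ->
  {in homogeneous n, f =1 g}.
Proof.
move=> fg x /eqP <-.
apply: (tens_ext (f := f \o tproj n) (g := g \o tproj n)) => s /=.
by rewrite tproj_ten; case: eqP => [/fg //|_]; rewrite !linear0.
Qed.

Lemma homog_img n p f :
    (forall s, size s = n -> f (ten s) \in homogeneous p) ->
  {in homogeneous n, forall x, f x \in homogeneous p}.
Proof.
move=> fh x xn; rewrite unfold_in; apply/eqP.
by apply: (homog_ext (f := tproj p \o f)) xn => s /fh /eqP.
Qed.

Lemma tcat_homog n p : {in homogeneous n & homogeneous p, forall x y, x ⊙ y \in homogeneous (n + p)}.
Proof.
move=> x y xn; apply: (homog_img (f := tcatr x)) => t tp.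
apply: (homog_img (f := tcatl (ten t))) xn => s sn.
by rewrite /= /tcatl tcat_ten -sn -tp -size_cat ten_homog.
Qed.

Lemma cons_homog a n x : x \in homogeneous n -> ten [:: a] ⊙ x \in homogeneous n.+1.
Proof.
move=> xn; rewrite -add1n; apply: tcat_homog => //.
exact: (ten_homog [:: a]).
Qed.

(** id (x) f.  Constants are sent to 0, so that the exchange rules between
    operators hold on short words too, where both sides vanish. *)
Definition tail_map f : {linear T -> T} := tmap 1 (tproj 1) f.
Local Notation R := tail_map.

Lemma tail_map_cons f a x : R f (ten [:: a] ⊙ x) = ten [:: a] ⊙ f x.
Proof.
apply: (tens_ext (f := R f \o tcatr _) (g := tcatr _ \o f)) => s /=.
by rewrite /tcatr tcat_ten tmap_ten /= take0 drop0 tproj_ten.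
Qed.

Lemma tail_map_ten f a s : R f (ten (a :: s)) = ten [:: a] ⊙ f (ten s).
Proof. by rewrite -tail_map_cons tcat_ten. Qed.

Lemma tail_map_nil f : R f (ten [::]) = 0.
Proof. by rewrite tmap_ten tproj_ten /= -/(tcatl _ _) linear0. Qed.

Local Opaque tail_map.

Lemma tcatx1 x : x ⊙ ten [::] = x.
Proof.
apply: (tens_ext (f := tcatl (ten [::])) (g := tid)) => s.
by rewrite /= /tcatl tcat_ten cats0.
Qed.

Lemma eq_tail_map f g : f =1 g -> R f =1 R g.
Proof.
by move=> fg; apply: tens_ext => -[|a s]; rewrite ?tail_map_nil ?tail_map_ten ?fg.
Qed.

Lemma tail_map_comp f g x : R (f \o g) x = R f (R g x).
Proof.
apply: (tens_ext (f := R (f \o g)) (g := R f \o R g)) => -[|a s] /=.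
  by rewrite !tail_map_nil linear0.
by rewrite !tail_map_ten tail_map_cons.
Qed.

Lemma tail_mapD f g x : R (f \+ g) x = R f x + R g x.
Proof.
apply: (tens_ext (f := R (f \+ g)) (g := R f \+ R g)) => -[|a s] /=.
  by rewrite !tail_map_nil addr0.
by rewrite !tail_map_ten /= linearDr.
Qed.

Lemma tail_map_homog n p f :
    {in homogeneous n, forall x, f x \in homogeneous p} ->
  {in homogeneous n.+1, forall x, R f x \in homogeneous p.+1}.
Proof.
move=> fh; apply: homog_img => -[|a s] //= [sn].
rewrite tail_map_ten -add1n; apply: tcat_homog; first exact: ten_homog.
by apply: fh; rewrite -sn; exact: ten_homog.
Qed.

Lemma eq_tail_map_homog n f g :
  {in homogeneous n, f =1 g} -> {in homogeneous n.+1, R f =1 R g}.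
Proof.
move=> fg; apply: (homog_ext (f := R f) (g := R g)) => s.
case: s => [|a s]; first by rewrite !tail_map_nil.
move=> [sn]; rewrite !tail_map_ten (fg (ten s)) // -sn.
exact: ten_homog.
Qed.

Context (sigma : {linear T -> T}) (mult : {linear T -> T}) (m : A -> A -> A).
Context (sigma_homog : forall x, tproj 2 (sigma x) = sigma x).
Context (sigma_ten0 : forall s, size s <> 2%N -> sigma (ten s) = 0).
Context (mult_ten : forall s,
  mult (ten s) = if s is [:: a; b] then ten [:: m a b] else 0).

Context (sg : nat -> {linear T -> T}).
Context (sgE : forall k, sg k = tmap k tid (tmap 2 sigma tid)).

Lemma sig_ten k s :
  sg k (ten s) = ten (take k s) ⊙ (sigma (ten (take 2 (drop k s)))
                                   ⊙ ten (drop 2 (drop k s))).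
Proof. by rewrite sgE !tmap_ten. Qed.

Lemma sig_ten_small k s : (size s < k.+2)%N -> sg k (ten s) = 0.
Proof.
move=> sk; rewrite sig_ten sigma_ten0 ?linear0l ?linear0r //.
by rewrite size_take size_drop; move: (size s) sk => n sk; case: ltnP; lia.
Qed.

Lemma sig_nil k : sg k (ten [::]) = 0.
Proof. exact: sig_ten_small. Qed.

Lemma sig_single k a : sg k (ten [:: a]) = 0.
Proof. exact: sig_ten_small. Qed.

Lemma sigS k x : sg k.+1 x = R (sg k) x.
Proof.
apply: tens_ext => -[|a s].
  by rewrite sig_nil tail_map_nil.
by rewrite tail_map_ten !sig_ten [in RHS]tcatA tcat_ten.
Qed.

Lemma sig_cat k n y :
  (k.+2 <= n)%N -> {in homogeneous n, forall z, sg k (z ⊙ y) = sg k z ⊙ y}.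
Proof.
move=> kn; apply: (homog_ext (f := sg k \o tcatl y) (g := tcatl y \o sg k)) => s sn.
rewrite /= /tcatl.
apply: (tens_ext (f := sg k \o tcatr (ten s)) (g := tcatr (sg k (ten s)))) => t.
rewrite /= /tcatr tcat_ten !sig_ten -!tcatA !tcat_ten.
rewrite takel_cat ?drop_cat; last by lia.
have -> : (k < size s)%N by lia.
rewrite takel_cat ?size_drop; last by lia.
rewrite drop_cat size_drop.
case: ltnP => s2; first by [].
have -> : (2 - (size s - k))%N = 0%N by lia.
rewrite drop0; suff -> : drop 2 (drop k s) = [::] by [].
by apply: drop_oversize; rewrite size_drop.
Qed.

Lemma sig_homog k n : {in homogeneous n, forall x, sg k x \in homogeneous n}.
Proof.
elim: k n => [|k IHk] n.
  apply: homog_img => s sn; case: (ltnP n 2) => n2.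
    by rewrite sig_ten_small ?sn // homog0.
  rewrite sig_ten take0 drop0 tcat1x -(subnKC n2).
  apply: tcat_homog; first by rewrite unfold_in sigma_homog.
  by rewrite -sn -size_drop ten_homog.
case: n => [|n] x xn.
  suff -> : sg k.+1 x = 0 by exact: homog0.
  apply: (homog_ext (f := sg k.+1) (g := \0)) xn => -[|//] _.
  exact: sig_nil.
by rewrite sigS; apply: tail_map_homog xn => {}x; apply: IHk.
Qed.

(** sigma and f act on different letters; the same reason gives
    [mul_head_tail2]. *)
Lemma sig0_tail2 f x : sg 0 (R (R f) x) = R (R f) (sg 0 x).
Proof.
apply: (tens_ext (f := sg 0 \o R (R f)) (g := R (R f) \o sg 0)) => -[|a [|b s]] /=.
- by rewrite tail_map_nil sig_nil !linear0.
- by rewrite tail_map_ten tail_map_nil sig_single linear0r !linear0.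
rewrite !tail_map_ten tcatA tcat_ten /= -[a :: b :: s]/([:: a; b] ++ s) -tcat_ten.
rewrite !(@sig_cat _ 2) ?ten_homog //.
apply: (homog_ext (f := tcatl (f (ten s))) (g := R (R f) \o tcatl (ten s)) (n := 2)).
  move=> [|c [|d []]] //= _; rewrite /= /tcatl tcat_ten !tail_map_ten.
  by rewrite tcatA tcat_ten.
exact/sig_homog/ten_homog.
Qed.

(** m (x) id *)
Definition mul_head : {linear T -> T} := tmap 2 mult tid.
Local Notation M := mul_head.

Lemma mul_head_ten a b s : M (ten [:: a, b & s]) = ten (m a b :: s).
Proof. by rewrite tmap_ten /= take0 drop0 mult_ten tcat_ten. Qed.

Lemma mul_head_ten_small s : (size s < 2)%N -> M (ten s) = 0.
Proof.
by case: s => [|a [|b s]] //= _; rewrite tmap_ten mult_ten linear0l.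
Qed.

Local Opaque mul_head.

Lemma mul_head_nil : M (ten [::]) = 0.
Proof. exact: mul_head_ten_small. Qed.

Lemma mul_head_single a : M (ten [:: a]) = 0.
Proof. exact: mul_head_ten_small. Qed.

Lemma mul_head_tail2 f x : M (R (R f) x) = R f (M x).
Proof.
apply: (tens_ext (f := M \o R (R f)) (g := R f \o M)) => -[|a [|b s]] /=.
- by rewrite tail_map_nil mul_head_nil !linear0.
- by rewrite tail_map_ten tail_map_nil mul_head_single linear0r !linear0.
rewrite mul_head_ten !tail_map_ten tcatA tcat_ten /=.
apply: (tens_ext (f := M \o tcatr (ten [:: a; b])) (g := tcatr (ten [:: m a b]))) => t.
by rewrite /= /tcatr !tcat_ten /= mul_head_ten.
Qed.

Lemma mul_head_homog n : {in homogeneous n.+1, forall x, M x \in homogeneous n}.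
Proof.
apply: homog_img => -[|a [|b s]] // [sn].
  by rewrite mul_head_single homog0.
by rewrite mul_head_ten -sn ten_homog.
Qed.

Lemma mul_head_cat n y : (2 <= n)%N -> {in homogeneous n, forall z, M (z ⊙ y) = M z ⊙ y}.
Proof.
move=> n2; apply: (homog_ext (f := M \o tcatl y) (g := tcatl y \o M)) => s sn.
rewrite /= /tcatl.
apply: (tens_ext (f := M \o tcatr (ten s)) (g := tcatr (M (ten s)))) => t.
case: s sn n2 => [|a [|b s]] <- // _.
by rewrite /= /tcatr tcat_ten !mul_head_ten tcat_ten.
Qed.

Context (m_assoc : associative m).
Context (braid3 : {in homogeneous 3, forall z,
  sg 0 (sg 1 (sg 0 z)) = sg 1 (sg 0 (sg 1 z))}).
Context (mull3 : {in homogeneous 3, forall z,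
  tmap 1 tid mult (sg 0 (sg 1 z)) = sigma (tmap 2 mult tid z)}).
Context (mulr3 : {in homogeneous 3, forall z,
  tmap 2 mult tid (sg 1 (sg 0 z)) = sigma (tmap 1 tid mult z)}).

Lemma sig0_homog2 : {in homogeneous 2, forall z, sg 0 z = sigma z}.
Proof.
apply: homog_ext => -[|a [|b []]] //= _.
by rewrite sig_ten /= tcat1x tcatx1.
Qed.

Lemma mul_head_homog2 : {in homogeneous 2, forall z, M z = mult z}.
Proof.
apply: homog_ext => -[|a [|b []]] //= _.
by rewrite mul_head_ten mult_ten.
Qed.

Lemma tail_map_homogS n f : {in homogeneous n.+1, forall z, R f z = tmap 1 tid f z}.
Proof.
apply: homog_ext => -[|a s] //= _.
by rewrite tail_map_ten tmap_ten /= take0 drop0.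
Qed.

Lemma ten_take_homog n s : (n <= size s)%N -> ten (take n s) \in homogeneous n.
Proof. by move=> ns; rewrite -{2}(size_takel ns) ten_homog. Qed.

(** The braid relation and the two compatibilities are given on three letters;
    they extend to all words because the operators only see those letters. *)
Lemma word_ext3 f g :
    (forall s, (size s < 3)%N -> f (ten s) = g (ten s)) ->
    (forall y, {in homogeneous 3, forall z, f (z ⊙ y) = f z ⊙ y}) ->
    (forall y, {in homogeneous 3, forall z, g (z ⊙ y) = g z ⊙ y}) ->
  {in homogeneous 3, f =1 g} -> f =1 g.
Proof.
move=> fg0 fy gy fg; apply: tens_ext => s.
case: (ltnP (size s) 3) => [/fg0 //|s3].
rewrite -(cat_take_drop 3 s) -tcat_ten.
by rewrite fy ?gy ?fg ?ten_take_homog.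
Qed.

Lemma sig1_small s : (size s < 3)%N -> sg 1 (ten s) = 0.
Proof. exact: sig_ten_small. Qed.

Lemma sig10_small s : (size s < 3)%N -> sg 1 (sg 0 (ten s)) = 0.
Proof.
move=> s3; apply: (homog_ext (f := sg 1) (g := \0)) (sig_homog 0 (ten_homog s)).
by move=> t ts; rewrite sig1_small // ts.
Qed.

Lemma sig0_braid x : sg 0 (sg 1 (sg 0 x)) = sg 1 (sg 0 (sg 1 x)).
Proof.
apply: (word_ext3 (f := sg 0 \o sg 1 \o sg 0) (g := sg 1 \o sg 0 \o sg 1))
  => [s s3|y z z3|y z z3|] /=.
- by rewrite sig1_small // sig10_small // !linear0.
- by rewrite !(@sig_cat _ 3) ?sig_homog.
- by rewrite !(@sig_cat _ 3) ?sig_homog.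
exact: braid3.
Qed.

Lemma sig_braid k x : sg k (sg k.+1 (sg k x)) = sg k.+1 (sg k (sg k.+1 x)).
Proof.
elim: k x => [|k IHk] x; first exact: sig0_braid.
rewrite !(sigS k.+1) !(sigS k) -!tail_map_comp.
exact: eq_tail_map.
Qed.

Lemma sig_comm k l x : (k.+1 < l)%N -> sg k (sg l x) = sg l (sg k x).
Proof.
elim: k l x => [|k IHk] [|[|l]] // x kl.
  have sE : sg l.+2 =1 R (R (sg l)).
    by move=> y; rewrite sigS; apply: eq_tail_map => {}y; rewrite sigS.
  by rewrite !sE sig0_tail2.
rewrite !(sigS k) !(sigS l.+1) -!tail_map_comp.
by apply: (eq_tail_map (f := sg k \o sg l.+1) (g := sg l.+1 \o sg k)) => y; apply: IHk.
Qed.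

Lemma mul_head_mul_head x : M (M x) = M (R M x).
Proof.
apply: (tens_ext (f := M \o M) (g := M \o R M)) => -[|a [|b [|c s]]] /=.
- by rewrite tail_map_nil mul_head_nil linear0.
- by rewrite tail_map_ten mul_head_single mul_head_nil linear0r !linear0.
- by rewrite tail_map_ten mul_head_ten !mul_head_single linear0r linear0.
by rewrite tail_map_ten !mul_head_ten tcat_ten mul_head_ten m_assoc.
Qed.

Lemma tail_mul_head_cat y : {in homogeneous 3, forall z, R M (z ⊙ y) = R M z ⊙ y}.
Proof.
apply: (homog_ext (f := R M \o tcatl y) (g := tcatl y \o R M)).
move=> [|a [|b [|c []]]] // _; rewrite /= /tcatl -[[:: _; _; _]]cat1s -tcat_ten.
by rewrite -tcatA !tail_map_cons (@mul_head_cat 2) ?ten_homog // tcatA.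
Qed.

Lemma tail_mul_head_homog3 : {in homogeneous 3, forall z, R M z = tmap 1 tid mult z}.
Proof.
move=> z z3; rewrite -(@tail_map_homogS 2) //.
exact: (eq_tail_map_homog mul_head_homog2).
Qed.

Lemma sig0_mul_head x : sg 0 (M x) = R M (sg 0 (sg 1 x)).
Proof.
apply: (word_ext3 (f := sg 0 \o M) (g := R M \o sg 0 \o sg 1))
  => [s s3|y z z3|y z z3|z z3] /=.
- rewrite sig1_small // !linear0; case: s s3 => [|a [|b [|]]] // _.
  + by rewrite mul_head_nil linear0.
  + by rewrite mul_head_single linear0.
  by rewrite mul_head_ten sig_single.
- by rewrite (@mul_head_cat 3) // (@sig_cat _ 2) // mul_head_homog.
- by rewrite !(@sig_cat _ 3) ?sig_homog // tail_mul_head_cat // !sig_homog.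
by rewrite tail_mul_head_homog3 ?sig_homog // mull3 // sig0_homog2 ?mul_head_homog.
Qed.

Lemma sig0_tail_mul_head x : sg 0 (R M x) = M (sg 1 (sg 0 x)).
Proof.
apply: (word_ext3 (f := sg 0 \o R M) (g := M \o sg 1 \o sg 0))
  => [s s3|y z z3|y z z3|z z3] /=.
- rewrite sig10_small // !linear0; case: s s3 => [|a [|b [|]]] // _.
  + by rewrite tail_map_nil linear0.
  + by rewrite tail_map_ten mul_head_nil linear0r linear0.
  by rewrite tail_map_ten mul_head_single linear0r linear0.
- rewrite tail_mul_head_cat // (@sig_cat _ 2) //.
  exact: (tail_map_homog (@mul_head_homog 1)).
- by rewrite !(@sig_cat _ 3) ?sig_homog // (@mul_head_cat 3) // !sig_homog.
rewrite -[RHS]/(tmap 2 mult tid _) mulr3 // sig0_homog2 ?tail_mul_head_homog3 //.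
by rewrite -tail_mul_head_homog3 //; apply: (tail_map_homog (@mul_head_homog 1)).
Qed.

(** * The recursion on the first letter of the right factor *)

Context (sig_word : seq nat -> {linear T -> T}).
Context (sig_wordE : forall ks x, sig_word ks x = act_word sg ks x).

Lemma sig_word0 x : sig_word [::] x = x.
Proof. exact: sig_wordE. Qed.

Lemma sig_word_cons k ks x : sig_word (k :: ks) x = sg k (sig_word ks x).
Proof. by rewrite !sig_wordE. Qed.

Lemma sig_word_cat ks ls x : sig_word (ks ++ ls) x = sig_word ks (sig_word ls x).
Proof. by rewrite !sig_wordE act_word_cat. Qed.

Lemma sig_word_homog n ks : {in homogeneous n, forall x, sig_word ks x \in homogeneous n}.
Proof.
elim: ks => [|k ks IH] x xn; first by rewrite sig_word0.
by rewrite sig_word_cons sig_homog // IH.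
Qed.

Lemma sig_word_shift ks a x :
  sig_word (map succn ks) (ten [:: a] ⊙ x) = ten [:: a] ⊙ sig_word ks x.
Proof.
elim: ks => [|k ks IH] /=; first by rewrite !sig_word0.
by rewrite !sig_word_cons IH sigS tail_map_cons.
Qed.

Context (tgraded : (nat -> {linear T -> T}) -> {linear T -> T}).
Context (tgraded_ten : forall h s, tgraded h (ten s) = h (size s) (ten s)).

Definition last_to_front := tgraded (fun n => sig_word (iota 0 n.-1)).

(** The braiding of a tensor with the letter b, on all degrees at once. *)
Definition push_front b : {linear T -> T} := last_to_front \o tcatl (ten [:: b]).

Lemma push_front_ten b s :
  push_front b (ten s) = sig_word (iota 0 (size s)) (ten (rcons s b)).
Proof. by rewrite /= /tcatl tcat_ten tgraded_ten cats1 size_rcons. Qed.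

Lemma push_front_nil b : push_front b (ten [::]) = ten [:: b].
Proof. by rewrite push_front_ten sig_word0. Qed.

Local Opaque push_front.

Lemma push_front_homog b n : {in homogeneous n, forall x, push_front b x \in homogeneous n.+1}.
Proof.
apply: homog_img => s <-; rewrite push_front_ten; apply: sig_word_homog.
by rewrite -(size_rcons s b) ten_homog.
Qed.

Lemma push_front_tail b f x :
  push_front b (R f x) = sg 0 (R (push_front b \o f) x).
Proof.
apply: (tens_ext (f := push_front b \o R f) (g := sg 0 \o R (push_front b \o f))).
move=> [|a s] /=.
  by rewrite !tail_map_nil !linear0.
rewrite !tail_map_ten.
apply: (tens_ext (f := push_front b \o tcatr (ten [:: a]))
                 (g := sg 0 \o tcatr (ten [:: a]) \o push_front b)) => t.
rewrite /= /tcatr tcat_ten !push_front_ten /=.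
by rewrite sig_word_cons (iotaDl 1 0) -[a :: _]cat1s -tcat_ten sig_word_shift.
Qed.

Context (Tperm : forall n, 'S_n -> {linear T -> T}).
Context (TpermE : forall n (w : 'S_n) x, Tperm w x =
  sig_word [seq val k | k <- xget [::] (reduced_expr w)] x).

Lemma sg_action : braid_action sg.
Proof. by split=> [k l x kl|k x]; [apply: sig_comm | apply: sig_braid]. Qed.

Lemma Tperm_code n (w : 'S_n) x : Tperm w x = sig_word (code_word (perm_code w)) x.
Proof. by rewrite TpermE !sig_wordE; apply: act_reduced_expr sg_action. Qed.

Context (beta : nat -> {linear T -> T}).
Context (beta0 : forall x, beta 0 x = x).
Context (betaS : forall i x, beta i.+1 x = Tperm (chi i.+1 1) x).

Lemma betaE i x : beta i x = sig_word (iota 0 i) x.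
Proof.
by case: i => [|i]; rewrite ?beta0 ?sig_word0 // betaS Tperm_code code_word_chi.
Qed.

Context (qat : nat -> nat -> {linear T -> T}).
Context (qat0 : forall j, qat 0 j = tid).
Context (qatS0 : forall i, qat i.+1 0 = tid).
Context (qatSS : forall i j x, qat i.+1 j.+1 x =
    tmap 1 tid (qat i j.+1) x
    + tmap 1 tid (qat i.+1 j) (tmap i.+2 (beta i.+1) tid x)
    + tmap 2 mult (qat i j) (tmap 1 tid (tmap i.+1 (beta i) tid) x)).
Context (qsh : {bilinear T -> T -> T}).
Context (qsh_ten : forall s t,
  qsh (ten s) (ten t) = qat (size s) (size t) (ten (s ++ t))).

Lemma qsh1x x : qsh (ten [::]) x = x.
Proof.
apply: (tens_ext (f := qsh (ten [::])) (g := tid)) => s.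
by rewrite /= qsh_ten qat0.
Qed.

Definition qshl y : T -> T := fun x => qsh x y.

Lemma qshl_linear y : linear (qshl y).
Proof. by move=> c x z; rewrite /qshl linearPl. Qed.

HB.instance Definition _ y :=
  GRing.isLinear.Build K T T *:%R (qshl y) (qshl_linear y).

Lemma qshx1 x : qsh x (ten [::]) = x.
Proof.
apply: (tens_ext (f := qshl (ten [::])) (g := tid)) => s.
by rewrite /= /qshl qsh_ten cats0; case: (size s) => [|n]; rewrite ?qat0 ?qatS0.
Qed.

Local Notation Q y := (R (qshl y)).

(** The defining recursion, with the letter b moved through the left factor by
    [push_front b].  Its last two terms are put together: b is moved up to the
    second position and then either jumps over the first letter or is
    multiplied with it.  [R tid] removes the constant term of the left factor,
    for which the recursion does not hold. *)
Lemma qsh_cons_r b v x :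
  let w := push_front b in
  qsh (R tid x) (ten (b :: v)) =
    Q (ten (b :: v)) x + Q (ten v) (sg 0 (R w x) + M (R w x)).
Proof.
move=> w; pose N := sg 0 \+ M : {linear T -> T}.
apply: (tens_ext (f := qshl (ten (b :: v)) \o R tid)
   (g := Q (ten (b :: v)) \+ (Q (ten v) \o N \o R w))) => -[|a u].
  by rewrite /= !tail_map_nil /qshl linear0l !linear0 !addr0 linear0 addr0.
rewrite [LHS]/= [RHS]/= !tail_map_ten /qshl /= tcat_ten !qsh_ten /= qatSS.
rewrite [in RHS]linearD /= -addrA; congr (_ + (_ + _)).
- by rewrite tmap_ten /= take0 drop0 /qshl qsh_ten.
- have -> : sg 0 (ten [:: a] ⊙ w (ten u)) = w (ten (a :: u)).
    by have := push_front_tail b tid (ten (a :: u)); rewrite !tail_map_ten tcat_ten.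
  have -> : tmap (size u).+2 (beta (size u).+1) tid (ten (a :: u ++ b :: v))
            = w (ten (a :: u)) ⊙ ten v.
    rewrite tmap_ten betaE /= push_front_ten.
    by rewrite -cat_rcons take_size_cat ?drop_size_cat ?size_rcons.
  have := push_front_homog b (ten_homog (a :: u)).
  apply: (homog_ext (f := tmap 1 tid (qat (size u).+1 (size v)) \o tcatl (ten v))
             (g := Q (ten v))) => -[|c t] // [tu].
  by rewrite /= /tcatl tcat_ten tmap_ten tail_map_ten /= take0 drop0 /qshl qsh_ten tu.
have -> : tmap 1 tid (tmap (size u).+1 (beta (size u)) tid) (ten (a :: u ++ b :: v))
          = ten [:: a] ⊙ (w (ten u) ⊙ ten v).
  rewrite tmap_ten /= take0 drop0 tmap_ten betaE push_front_ten.
  by rewrite -cat_rcons take_size_cat ?drop_size_cat ?size_rcons.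
have := push_front_homog b (ten_homog u).
apply: (homog_ext
    (f := tmap 2 mult (qat (size u) (size v)) \o tcatr (ten [:: a]) \o tcatl (ten v))
    (g := Q (ten v) \o M \o tcatr (ten [:: a]))) => -[|c t] // [tu].
rewrite /= /tcatl /tcatr !tcat_ten tmap_ten mul_head_ten tail_map_ten /=.
by rewrite take0 drop0 mult_ten /qshl qsh_ten tu.
Qed.

(** * The product with a letter *)

(** The operator sending a (x) x to the product of a and x, on all degrees at
    once. *)
Definition letter_shuffle : {linear T -> T} :=
  tgraded (fun n => if n is n'.+1 then qat 1 n' else \0).
Local Notation J := letter_shuffle.

Lemma letter_shuffle_nil : J (ten [::]) = 0.
Proof. by rewrite tgraded_ten. Qed.

Lemma letter_shuffle_cons a x : J (ten [:: a] ⊙ x) = qsh (ten [:: a]) x.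
Proof.
apply: (tens_ext (f := J \o tcatr (ten [:: a])) (g := qsh (ten [:: a]))) => s.
by rewrite /= /tcatr tcat_ten tgraded_ten qsh_ten.
Qed.

Lemma letter_shuffle_ten a s : J (ten (a :: s)) = qsh (ten [:: a]) (ten s).
Proof. by rewrite -letter_shuffle_cons tcat_ten. Qed.

Local Opaque letter_shuffle.

(** The letter stays in front, jumps over the next one, or is multiplied with
    it. *)
Lemma letter_shuffleE x : J x = R tid x + R J (sg 0 x) + M x.
Proof.
apply: (tens_ext (f := J) (g := R tid \+ (R J \o sg 0) \+ M)) => -[|a [|b v]].
- by rewrite /= letter_shuffle_nil tail_map_nil mul_head_nil sig_nil !linear0 !addr0.
- rewrite /= letter_shuffle_ten qshx1 tail_map_ten mul_head_single sig_single.
  by rewrite !linear0 !addr0 tcatx1.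
have -> : J (ten (a :: b :: v)) = qsh (R tid (ten [:: a])) (ten (b :: v)).
  by rewrite letter_shuffle_ten tail_map_ten tcat_ten.
rewrite qsh_cons_r /= !tail_map_ten push_front_nil tcat_ten /= linearD /= addrA.
congr (_ + _ + _).
- by rewrite /= /qshl qsh1x.
- rewrite -[[:: a, b & v]]/([:: a; b] ++ v) -tcat_ten (@sig_cat _ 2) ?ten_homog //.
  have := sig_homog 0 (ten_homog [:: a; b]).
  apply: (homog_ext (f := Q (ten v)) (g := R J \o tcatl (ten v))) => -[|c [|d []]] // _.
  by rewrite /= /tcatl tcat_ten !tail_map_ten /= letter_shuffle_ten.
by rewrite !mul_head_ten tail_map_ten /= /qshl qsh1x tcat_ten.
Qed.

Lemma tail_map_tail f x : R tid (R f x) = R f x.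
Proof. by rewrite -tail_map_comp; apply: eq_tail_map. Qed.

Lemma tail2_sig0 x : R (R tid) (sg 0 x) = sg 0 x.
Proof.
rewrite -sig0_tail2.
apply: (tens_ext (f := sg 0 \o R (R tid)) (g := sg 0)) => -[|a [|b s]] /=.
- by rewrite tail_map_nil linear0 sig_nil.
- by rewrite tail_map_ten tail_map_nil linear0r linear0 sig_single.
by rewrite !tail_map_ten /= !tcat_ten.
Qed.

Lemma tail_mul_head x : R tid (M x) = M x.
Proof.
rewrite -mul_head_tail2.
apply: (tens_ext (f := M \o R (R tid)) (g := M)) => -[|a [|b s]] /=.
- by rewrite tail_map_nil linear0 mul_head_nil.
- by rewrite tail_map_ten tail_map_nil linear0r linear0 mul_head_single.
by rewrite !tail_map_ten /= !tcat_ten.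
Qed.

Lemma letter_shuffle_tail x : R tid (J x) = J x.
Proof.
by rewrite letter_shuffleE !linearD /= !tail_map_tail tail_mul_head.
Qed.

Lemma push_front_tail_id b x : push_front b (R tid x) = sg 0 (R (push_front b) x).
Proof. by rewrite push_front_tail; congr (sg 0 _); apply: eq_tail_map. Qed.

Lemma tail_push_front b x :
  R (push_front b) (R (R tid) x) = sg 1 (R (R (push_front b)) x).
Proof.
rewrite -tail_map_comp sigS -tail_map_comp.
by apply: eq_tail_map => y /=; apply: push_front_tail_id.
Qed.

Lemma push_front_sig0 b x :
  R (push_front b) (sg 0 x) = sg 1 (sg 0 (R (R (push_front b)) x)).
Proof. by rewrite -[in LHS]tail2_sig0 tail_push_front sig0_tail2. Qed.

Lemma tail_letter_sig0 x :
  R J (sg 0 x) = sg 0 x + R (R J) (sg 1 (sg 0 x)) + R M (sg 0 x).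
Proof.
have JE : J =1 (R tid \+ (R J \o sg 0) \+ M) by move=> y; rewrite letter_shuffleE.
by rewrite (eq_tail_map JE) !tail_mapD tail_map_comp tail2_sig0 sigS.
Qed.

(** Naturality of the braiding with respect to the product with a letter.  After
    an expansion of both sides by [letter_shuffleE], the terms without
    multiplication agree by induction and the braid relation, those with
    a multiplication by the compatibility of sigma and m. *)
Lemma push_front_letter b x : push_front b (J x) = R J (push_front b x).
Proof.
have step n : (forall s, size s = n ->
    push_front b (J (ten s)) = R J (push_front b (ten s))) ->
  {in homogeneous n, (push_front b \o J : {linear T -> T}) =1
               (R J \o push_front b : {linear T -> T})}.
  by move=> ext_n; apply: homog_ext.
apply: (tens_ext (f := push_front b \o J) (g := R J \o push_front b)) => s /=.
move: {2}(size s) (erefl (size s)) => n; elim: n s => [|n IHn] s sn.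
  case: s sn => // _.
  by rewrite push_front_nil letter_shuffle_nil tail_map_ten letter_shuffle_nil !linear0.
case: s sn => // a [|a' s] sn.
  have w1 : push_front b (ten [:: a]) = sg 0 (ten [:: a; b]).
    by rewrite push_front_ten.
  rewrite letter_shuffle_ten qshx1 w1.
  have := sig_homog 0 (ten_homog [:: a; b]).
  apply: (homog_ext (f := tid) (g := R J)) => -[|c [|d []]] // _.
  by rewrite tail_map_ten letter_shuffle_ten qshx1 tcat_ten.
(* Of the word, only that it has at least two letters matters from here on. *)
move: (ten_homog (a :: a' :: s)); rewrite sn => xn.
have xE : R (R tid) (ten (a :: a' :: s)) = ten (a :: a' :: s).
  by rewrite !tail_map_ten /= !tcat_ten.
move: (ten _) xn xE => {}x xn xE; set w := push_front b.
have wE : w x = sg 0 (R w x).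
  by rewrite -[in LHS]xE -tail_map_tail push_front_tail_id xE.
have RwE : R w x = sg 1 (R (R w) x) by rewrite -[in LHS]xE tail_push_front.
have wJ : w (R J (sg 0 x)) = sg 0 (R (R J) (R w (sg 0 x))).
  rewrite [LHS](push_front_tail b J) -[in RHS]tail_map_comp; congr (sg 0 _).
  by apply: (eq_tail_map_homog (step _ IHn)); apply: sig_homog.
have wM : w (M x) = sg 0 (M (R (R w) x)).
  by rewrite mul_head_tail2 -tail_mul_head push_front_tail_id tail_mul_head.
rewrite letter_shuffleE !linearD /= wJ wM push_front_sig0.
rewrite -[X in X + _ + _]/(w (R tid x)).
have -> : R tid x = x by rewrite -[in LHS]xE tail_map_tail xE.
rewrite wE RwE tail_letter_sig0.
by rewrite -/w (sig0_tail2 J) sig0_braid sig0_mul_head.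
Qed.

(** * Inserting a letter into an interval product *)

(** The sum of m_{cp(S)} over the sets S of ascents, for the ascent bits [e].
    A block is multiplied from the right, as in m^k = m (id (x) m^{k-1}), hence a
    joined first letter acts by m on the result for the other letters. *)
Fixpoint ascent_mul (e : bitseq) : {linear T -> T} :=
  match e with
  | [::] => tproj 1
  | false :: e' => R (ascent_mul e')
  | true :: e' => R (ascent_mul e') \+ (M \o R (ascent_mul e'))
  end.

Definition to_position p := sig_word (rev (iota 0 p)).

Lemma sig_word_tail ks x : sig_word (map succn ks) (R tid x) = R (sig_word ks) x.
Proof.
apply: (tens_ext (f := sig_word (map succn ks) \o R tid) (g := R (sig_word ks))).
move=> -[|a s] /=.
  by rewrite !tail_map_nil linear0.
by rewrite !tail_map_ten sig_word_shift.
Qed.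

Lemma rev_iota0S p : rev (iota 0 p.+1) = rcons (map succn (rev (iota 0 p))) 0%N.
Proof. by rewrite /= (iotaDl 1 0) rev_cons map_rev. Qed.

Lemma to_positionS p x : to_position p.+1 x = R (to_position p) (sg 0 x).
Proof.
rewrite /to_position rev_iota0S -cats1 sig_word_cat sig_word_cons sig_word0.
by rewrite -[in LHS]tail2_sig0 -tail_map_tail sig_word_tail tail2_sig0.
Qed.

Lemma to_position0 x : to_position 0 x = x.
Proof. exact: sig_word0. Qed.

Lemma to_position1 x : to_position 1 x = sg 0 x.
Proof.
rewrite to_positionS -[RHS]tail2_sig0 -[RHS]tail_map_tail tail2_sig0.
by apply: eq_tail_map => y; apply: to_position0.
Qed.

Lemma tail_map_sum I (r : seq I) f (h : I -> {linear T -> T}) :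
  (forall x, f x = \sum_(i <- r) h i x) ->
  forall x, R f x = \sum_(i <- r) R (h i) x.
Proof.
move=> fE x.
pose F x := \sum_(i <- r) R (h i) x.
have Flin : linear F.
  move=> c y z; rewrite /F scaler_sumr -big_split /=.
  by apply: eq_bigr => i _; rewrite linearP.
pose Fl : {linear T -> T} := HB.pack F (GRing.isLinear.Build K T T *:%R F Flin).
apply: (tens_ext (f := R f) (g := Fl)) => -[|a s]; rewrite /= /F.
  by rewrite tail_map_nil big1 // => i _; rewrite tail_map_nil.
rewrite tail_map_ten fE linear_sumr; apply: eq_bigr => i _.
by rewrite tail_map_ten.
Qed.

Lemma tail_letter_ascent_nil x :
  R J (sg 0 (R (tproj 1) x)) = R (tproj 1) (sg 0 x).
Proof.
apply: (tens_ext (f := R J \o sg 0 \o R (tproj 1)) (g := R (tproj 1) \o sg 0)).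
move=> s /=; have := sig_homog 0 (ten_homog s).
move: s => -[|a [|b [|c s]]] /=.
- by rewrite tail_map_nil sig_nil !linear0.
- by rewrite tail_map_ten tproj_ten sig_single !linear0.
- rewrite tail_map_ten tproj_ten /= tcat_ten.
  apply: (homog_ext (f := R J) (g := R (tproj 1))) => -[|d [|e []]] // _.
  by rewrite !tail_map_ten letter_shuffle_ten qshx1 tproj_ten.
rewrite tail_map_ten tproj_ten /= linear0 !linear0 => sh; apply/esym.
apply: (homog_ext (f := R (tproj 1)) (g := \0)) sh => -[|d [|e [|h u]]] // _.
by rewrite tail_map_ten tproj_ten /= linear0.
Qed.

(** The terms in which the inserted letter jumps at least once.  If the next
    letter is a block by itself, the jump over it is followed by all the terms
    for the rest.  If it is joined to its successor, sigma passes through their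
    product by jumping over both, so at least one more jump follows. *)
Lemma tail_letter_ascent e x :
  R J (sg 0 (R (ascent_mul e) x)) =
  \sum_(0 <= p < (size e).+1)
    ascent_mul (insert_ascent p.+1 e) (to_position p.+1 x).
Proof.
elim: e x => [|b e IHe] x.
  by rewrite big_nat1 to_position1 /= tail_letter_ascent_nil.
(* The terms without a jump, in which the letter stays alone or joins the first
   block, are those of the position p = 0. *)
have full y : J (R (ascent_mul e) y) =
    \sum_(0 <= p < (size e).+2) ascent_mul (insert_ascent p e) (to_position p y).
  rewrite letter_shuffleE IHe tail_map_tail [in RHS]big_nat_recl // to_position0.
  by rewrite addrAC; case: e {IHe}.
have fullR y : R J (R (R (ascent_mul e)) (sg 0 y)) =
    \sum_(0 <= p < (size e).+2) R (ascent_mul (insert_ascent p e)) (to_position p.+1 y).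
  rewrite -tail_map_comp.
  under eq_bigr do rewrite to_positionS -tail_map_comp.
  by apply: (tail_map_sum
    (h := fun p => ascent_mul (insert_ascent p e) \o to_position p)).
case: b; last by rewrite sig0_tail2 fullR.
rewrite [RHS]big_nat_recl // to_position1 /= tail_mapD tail_map_comp !linearD /=.
rewrite sig0_tail2 fullR.
rewrite sig0_tail_mul_head.
have -> : sg 1 (sg 0 (R (R (ascent_mul e)) x)) =
    R (sg 0 \o R (ascent_mul e)) (sg 0 x).
  by rewrite sig0_tail2 sigS -tail_map_comp.
rewrite -mul_head_tail2 -tail_map_comp.
have -> : R (R J \o (sg 0 \o R (ascent_mul e))) (sg 0 x) =
    \sum_(0 <= p < (size e).+1)
      R (ascent_mul (insert_ascent p.+1 e)) (to_position p.+2 x).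
  under eq_bigr do rewrite to_positionS -tail_map_comp.
  by apply: (tail_map_sum
    (h := fun p => ascent_mul (insert_ascent p.+1 e) \o to_position p.+1)).
rewrite [X in X + _]big_nat_recl // linear_sum -addrA -big_split to_position1.
by [].
Qed.

Lemma letter_shuffle_ascent e x :
  J (R (ascent_mul e) x) =
  \sum_(0 <= p < (size e).+2) ascent_mul (insert_ascent p e) (to_position p x).
Proof.
rewrite letter_shuffleE tail_letter_ascent tail_map_tail [in RHS]big_nat_recl //.
by rewrite to_position0 addrAC; case: e.
Qed.

(** * Associativity with a letter *)

Lemma letter_shuffle_tail_id x : J (R tid x) = J x.
Proof.
apply: (tens_ext (f := J \o R tid) (g := J)) => -[|a s] /=.
  by rewrite tail_map_nil letter_shuffle_nil linear0.
by rewrite tail_map_ten /= tcat_ten.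
Qed.

(** Induction on the right factor b (x) v and, for a given one, on the degree of
    the left factor.  Expanding both sides by [qsh_cons_r] and
    [letter_shuffleE], one is left with terms in [X], the left factor with b
    pushed to its third position; they agree by the relations between sigma
    and m and by the associativity of m. *)
Lemma qsh_letter_word x t : qsh (J x) (ten t) = J (Q (ten t) x).
Proof.
elim: t x => [|b v IHv] x.
  have Q1 z : Q (ten [::]) z = R tid z.
    by apply: eq_tail_map => {}z; apply: qshx1.
  by rewrite qshx1 Q1 letter_shuffle_tail_id.
pose y := ten (b :: v); pose q := Q (ten v); pose w := push_front b.
have qJ z : q (R J z) = R J (R q z).
  by rewrite -!tail_map_comp; apply: eq_tail_map => {}z /=; apply: IHv.
apply: (tens_ext (f := qshl y \o J) (g := J \o Q y)) => s /=.
move: {2}(size s) (erefl (size s)) => n; elim: n s => [|n IHn] s sn.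
  case: s sn => // _.
  by rewrite tail_map_nil letter_shuffle_nil !linear0.
case: s sn => // a [|a' s] sn.
  by rewrite tail_map_ten letter_shuffle_ten qshx1 letter_shuffle_cons /= /qshl qsh1x.
move: (ten_homog (a :: a' :: s)); rewrite sn => xn.
set x' := ten _; pose X := R (R w) x'.
have x'E : R (R tid) x' = x' by rewrite /x' !tail_map_ten /= !tcat_ten.
have QxE : Q y x' = R (Q y) x' + R q (sg 1 X + R M X).
  rewrite -[in LHS]x'E -tail_map_comp.
  rewrite (eq_tail_map (g := Q y \+ (q \o (sg 0 \+ M) \o R w))).
    by rewrite tail_mapD !tail_map_comp tail_mapD -sigS.
  by move=> z; apply: qsh_cons_r.
have qJx : qshl y (J x') = Q y (J x') + q (sg 0 (R w (J x')) + M (R w (J x'))).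
  by rewrite -{1}letter_shuffle_tail; apply: qsh_cons_r.
have QJx : Q y (J x') = Q y x' + R J (R (Q y) (sg 0 x')) + Q y (M x').
  rewrite {1}letter_shuffleE !linearD /=; congr (_ + _ + _).
    by rewrite -tail_map_comp; apply: eq_tail_map.
  rewrite -!tail_map_comp.
  apply: (eq_tail_map_homog (n := n)); last exact: sig_homog.
  apply: (homog_ext (f := qshl y \o J) (g := J \o Q y)) => t tn.
  exact: IHn.
have wJx : R w (J x') = sg 1 X + R (R J) (sg 1 (sg 0 X)) + M X.
  rewrite letter_shuffleE !linearD /=; congr (_ + _ + _).
  - by rewrite -[in LHS]x'E tail_map_tail tail_push_front.
  - rewrite -push_front_sig0 -!tail_map_comp; apply: eq_tail_map => z.
    exact: push_front_letter.
  by rewrite mul_head_tail2.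
have JQx : J (Q y x') = Q y x' + R J (R (Q y) (sg 0 x'))
      + (R J (R q (sg 0 (sg 1 X))) + R J (R q (M (sg 1 (sg 0 X)))))
      + (Q y (M x') + (q (M (sg 1 X)) + q (M (R M X)))).
  rewrite letter_shuffleE tail_map_tail QxE !linearD /=.
  clearbody X.
  by rewrite /q !sig0_tail2 !mul_head_tail2 sig0_tail_mul_head !addrA.
have qS : R J (R q (sg 0 (sg 1 X))) =
    q (sg 0 (sg 1 X)) + q (R (R J) (sg 0 (sg 1 (sg 0 X)))) + q (sg 0 (M X)).
  by rewrite -qJ tail_letter_sig0 -sig0_braid sig0_mul_head !linearD.
rewrite qJx QJx wJx JQx qS !linearD /=.
rewrite (sig0_tail2 J) (mul_head_tail2 J) qJ mul_head_mul_head !addrA.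
by rewrite [LHS](ACl (1*2*4*5*6*8*3*7*9)).
Qed.

(** * Interval products by bits *)

Context (mulpow : nat -> {linear T -> T}).
Context (mulpow0 : forall x, mulpow 0 x = x).
Context (mulpowS : forall k x, mulpow k.+1 x = mult (tmap 1 tid (mulpow k) x)).
Context (mul_comp : seq nat -> {linear T -> T}).
Context (mul_comp0 : forall x, mul_comp [::] x = x).
Context (mul_comp_cons : forall i I x,
  mul_comp (i :: I) x = tmap i (mulpow i.-1) (mul_comp I) x).

Fixpoint bit_mul (u : bitseq) : {linear T -> T} :=
  match u with
  | [::] => tproj 1
  | false :: u' => R (bit_mul u')
  | true :: u' => M \o R (bit_mul u')
  end.

Lemma ascent_mul_sum e x : ascent_mul e x = \sum_(u <- sub_bits e) bit_mul u x.
Proof.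
elim: e x => [|b e IHe] x; first by rewrite big_seq1.
rewrite big_cat big_map /=; case: b => /=; last first.
  by rewrite big_nil addr0; apply: tail_map_sum.
by rewrite big_map (tail_map_sum IHe) linear_sum.
Qed.

Lemma mulpow_head k : {in homogeneous k.+2, forall x, mulpow k.+1 x = M (R (mulpow k) x)} /\
  {in homogeneous k.+1, forall x, mulpow k x \in homogeneous 1}.
Proof.
elim: k => [|k [_ IHk]].
  have mul1 : {in homogeneous 1, forall x, mulpow 0 x \in homogeneous 1}.
    by move=> x; rewrite mulpow0.
  split=> // x x2; rewrite mulpowS -(@tail_map_homogS 1) // -mul_head_homog2 //.
  exact: (tail_map_homog mul1).
have mulS : {in homogeneous k.+2, forall x, mulpow k.+1 x = M (R (mulpow k) x)}.
  move=> x xk; rewrite mulpowS -(@tail_map_homogS k.+1) // -mul_head_homog2 //.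
  exact: (tail_map_homog IHk).
have mul1 : {in homogeneous k.+2, forall x, mulpow k.+1 x \in homogeneous 1}.
  by move=> x xk; rewrite mulS //; apply/mul_head_homog/(tail_map_homog IHk).
split=> // x xk; rewrite mulpowS -(@tail_map_homogS k.+2) // -mul_head_homog2 //.
exact: (tail_map_homog mul1).
Qed.

Lemma mul_comp_head i I s : (i.+1 < size s)%N ->
  mul_comp (i.+2 :: I) (ten s) = M (R (mul_comp (i.+1 :: I)) (ten s)).
Proof.
case: s => // a s is_; rewrite tail_map_ten !mul_comp_cons !tmap_ten /=.
have [mulE mul1] := mulpow_head i.
have t_i : ten (take i.+1 s) \in homogeneous i.+1 by apply: ten_take_homog.
rewrite mulE; last by rewrite -cat1s -tcat_ten cons_homog.
rewrite tail_map_ten tcatA (@mul_head_cat 2 (mul_comp I _)) //.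
by apply: cons_homog; apply: mul1.
Qed.

Lemma run_lengths_head (u : bitseq) : exists r I,
  forall l, run_lengths l u = (l + r)%N :: I /\ (r <= size u)%N.
Proof.
elim: u => [|b u [r [I uE]]]; first by exists 0%N, [::] => l; rewrite addn0.
case: b; last by exists 0%N, (run_lengths 1 u) => l; rewrite addn0.
exists r.+1, I => l /=; have [-> ru] := uE l.+1.
by rewrite addSnnS.
Qed.

(** Reading the intervals letter by letter: joining one more letter in front of
    an interval multiplies it with the product of that interval. *)
Lemma mul_comp_bits (u : bitseq) :
  {in homogeneous (size u).+1, mul_comp (run_lengths 1 u) =1 bit_mul u}.
Proof.
elim: u => [|b u IHu].
  apply: homog_ext => -[|a []] // _.
  by rewrite /= mul_comp_cons tmap_ten mulpow0 mul_comp0 tproj_ten tcat_ten.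
apply: homog_ext => -[|a s] // [su]; case: b su => /= su.
  have [r [I uE]] := run_lengths_head u.
  have [-> ru] := uE 2; rewrite mul_comp_head /=; last by rewrite su !ltnS.
  have [rE _] := uE 1; rewrite -[r.+1 :: I]rE; congr (M _).
  by apply: (eq_tail_map_homog IHu); rewrite -su (ten_homog (a :: s)).
rewrite mul_comp_cons tmap_ten /= take0 drop0 mulpow0 tail_map_ten IHu //.
by rewrite -su ten_homog.
Qed.

(** * Products of letters *)

Lemma Tperm_lift n p (v : 'S_n) a x :
  Tperm (lift_perm ord0 p v) (ten [:: a] ⊙ x)
  = to_position p (ten [:: a] ⊙ Tperm v x).
Proof.
by rewrite !Tperm_code perm_code_lift /= sig_word_cat sig_word_shift.
Qed.

Definition letter_prod (s : seq A) : T := \big[qsh/ten [::]]_(a <- s) ten [:: a].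

(** [letter_shuffle_ascent] sums over the pairs of a position p for the first
    letter and a permutation of the others, and [lift_perm ord0] makes them into
    the permutations of all the letters. *)
Lemma letter_prod_code n s : size s = n.+1 ->
  letter_prod s =
  \sum_(w : 'S_n.+1) ascent_mul (ascent_bits (perm_code w)) (Tperm w (ten s)).
Proof.
elim: n s => [|n IHn] [|a s] // [sn].
  case: s sn => // _; rewrite /letter_prod big_cons big_nil qshx1.
  rewrite (big_pred1 1%g) => [|w]; last first.
    by apply/esym/eqP/permP => i; rewrite perm1 !ord1.
  rewrite Tperm_code.
  have -> : perm_code (1 : 'S_1)%g = [:: 0%N].
    by apply: perm_codeP => // i; rewrite perm1 ord1.
  by rewrite /= sig_word0 tproj_ten.
rewrite /letter_prod big_cons -/(letter_prod s) (IHn s) // linear_sum /=.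
rewrite (reindex _ (onW_bij _ (@lift_perm0_bij n.+1))) /=.
rewrite -(pair_big xpredT xpredT (fun p v =>
   ascent_mul (ascent_bits (perm_code (lift_perm ord0 p v)))
     (Tperm (lift_perm ord0 p v) (ten (a :: s))))) exchange_big.
apply: eq_bigr => v _.
rewrite -letter_shuffle_cons -tail_map_cons letter_shuffle_ascent.
have size_e : size (ascent_bits (perm_code v)) = n.
  by rewrite size_map size_iota size_perm_code.
rewrite size_e big_mkord; apply: eq_bigr => p _; cbv beta.
rewrite perm_code_lift (@ascent_bits_cons p (perm_code v)) ?size_perm_code ?leq_ord //.
by rewrite -[a :: s]cat1s -tcat_ten Tperm_lift.
Qed.

Lemma letter_prod_sum n s : size s = n -> (0 < n)%N ->
  letter_prod s =
  \sum_(p : 'S_n * {set 'I_n * 'I_n} | p.2 \subset ascents p.1)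
     mul_comp (cp p.2) (Tperm p.1 (ten s)).
Proof.
case: n => // n sn _; rewrite (letter_prod_code sn).
rewrite -(pair_big_dep xpredT
  (fun (w : 'S_n.+1) (S : {set 'I_n.+1 * 'I_n.+1}) => S \subset ascents w)
  (fun w S => mul_comp (cp S) (Tperm w (ten s)))) /=.
apply: eq_bigr => w _.
have xn : Tperm w (ten s) \in homogeneous n.+1.
  by rewrite Tperm_code; apply: sig_word_homog; rewrite -sn ten_homog.
rewrite ascent_mul_sum.
rewrite [RHS](sum_ascent_sets w
  (fun u : bitseq => mul_comp (run_lengths 1 u) (Tperm w (ten s)))).
rewrite !big_seq; apply: eq_bigr => u; rewrite mem_sub_bits => /andP[/eqP ue _].
by rewrite mul_comp_bits // ue size_map size_iota size_perm_code.
Qed.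

(** * The subalgebra generated by the letters *)

Lemma qsh_letter_assoc a x y :
  qsh (qsh (ten [:: a]) x) y = qsh (ten [:: a]) (qsh x y).
Proof.
apply: (tens_ext (f := qsh (qsh (ten [:: a]) x))
                 (g := qsh (ten [:: a]) \o qsh x)) => t.
by rewrite /= -!letter_shuffle_cons qsh_letter_word tail_map_cons letter_shuffle_cons.
Qed.

Lemma letter_prod_cat s t : qsh (letter_prod s) (letter_prod t) = letter_prod (s ++ t).
Proof.
elim: s => [|a s IHs]; first by rewrite {1}/letter_prod big_nil qsh1x.
by rewrite /letter_prod !big_cons -!/(letter_prod _) qsh_letter_assoc IHs.
Qed.

Context (ten_span : forall x, exists cs : seq (K * seq A),
  x = \sum_(c <- cs) c.1 *: ten c.2).

Definition lin_closed (B : set T) : Prop :=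
  B 0 /\ forall (c : K) x y, B x -> B y -> B (c *: x + y).

Lemma lin_closed_sum B (cs : seq (K * seq A)) (h : seq A -> T) :
  lin_closed B -> (forall s, B (h s)) -> B (\sum_(c <- cs) c.1 *: h c.2).
Proof.
move=> [B0 Blin] Bh; elim: cs => [|c cs IHcs]; first by rewrite big_nil.
by rewrite big_cons; apply: Blin.
Qed.

(** An element of degree n is a combination of words, and those of the wrong
    length may be projected away. *)
Lemma homog_ind B n f : lin_closed B ->
  (forall s, size s = n -> B (f (ten s))) -> forall x, x \in homogeneous n -> B (f x).
Proof.
move=> Blin Bf x /eqP <-; have [cs ->] := ten_span x.
rewrite !linear_sum; under eq_bigr => c _ do rewrite !linearZ /=.
apply: (@lin_closed_sum B cs (fun s => f (tproj n (ten s)))) => // s.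
rewrite tproj_ten; case: eqP => [/Bf //|_].
by rewrite linear0; case: Blin.
Qed.

Definition perm_sum n (x : T) : T :=
  \sum_(p : 'S_n * {set 'I_n * 'I_n} | p.2 \subset ascents p.1)
     mul_comp (cp p.2) (Tperm p.1 x).

Lemma perm_sum_linear n : linear (perm_sum n).
Proof.
move=> c x y; rewrite /perm_sum scaler_sumr -big_split.
by apply: eq_bigr => p _; rewrite !linearP.
Qed.

HB.instance Definition _ n :=
  GRing.isLinear.Build K T T *:%R (perm_sum n) (perm_sum_linear n).

Context (E : nat -> set T).
Context (E0 : E 0 = range (fun c : K => c *: ten [::])).
Context (ES : forall n y,
  E n.+1 y <-> exists2 x, x \in homogeneous n.+1 & y = perm_sum n.+1 x).

Lemma letter_prod_nil : letter_prod [::] = ten [::].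
Proof. exact: big_nil. Qed.

Lemma perm_sum_ten n s : size s = n.+1 -> perm_sum n.+1 (ten s) = letter_prod s.
Proof. by move=> sn; rewrite (letter_prod_sum sn). Qed.

Lemma sub_component n B : lin_closed B ->
  (forall s, size s = n -> B (letter_prod s)) -> forall y, E n y -> B y.
Proof.
move=> Blin BP; have [B0 BZD] := Blin; case: n BP => [|n] BP y.
  rewrite E0 => -[c _ <-]; rewrite -[_ *: _]addr0; apply: BZD => //.
  by rewrite -letter_prod_nil; apply: BP.
move=> /ES[x xn ->]; apply: (homog_ind Blin) xn => s sn /=.
by rewrite perm_sum_ten //; apply: BP.
Qed.

Lemma component_letter_prod s : E (size s) (letter_prod s).
Proof.
case: s => [|a s].
  by rewrite letter_prod_nil E0; exists 1; rewrite ?scale1r.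
apply/ES; exists (ten (a :: s)); first exact: (ten_homog (a :: s)).
by rewrite perm_sum_ten.
Qed.

Lemma component_lin n : lin_closed (E n).
Proof.
case: n => [|n].
  rewrite E0; split; first by exists 0; rewrite ?scale0r.
  move=> c _ _ [d _ <-] [e _ <-]; exists (c * d + e) => //.
  by rewrite scalerDl scalerA.
split; first by apply/ES; exists 0; rewrite ?homog0 ?linear0.
move=> c _ _ /ES[x xn ->] /ES[y yn ->]; apply/ES.
exists (c *: x + y); last by rewrite linearP.
by move: xn yn; rewrite !unfold_in linearP => /eqP-> /eqP->.
Qed.

Local Notation D := (sum_subspaces E).

Lemma sum_components_lin : lin_closed D.
Proof.
split.
  exists 0%N, (fun=> 0); rewrite big_ord0; split=> // n.
  by have [] := component_lin n.
move=> c _ _ [N [y [Ey ->]]] [M' [z [Ez ->]]].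
exists (N + M')%N, (fun n => c *: (if (n < N)%N then y n else 0)
                            + (if (n < M')%N then z n else 0)).
split=> [n|].
  have [E0n En] := component_lin n.
  by apply: En; case: ifP.
rewrite big_split -scaler_sumr -!big_mkcond /=.
by rewrite -!(big_ord_widen (N + M')) ?leq_addl ?leq_addr.
Qed.

Lemma sub_sum_components n y : E n y -> D y.
Proof.
move=> Ey; exists n.+1, (fun k => if k == n then y else 0); split=> [k|].
  by case: eqP => [->//|_]; have [] := component_lin k.
rewrite big_ord_recr /= eqxx big1 ?add0r // => i _.
by rewrite ltn_eqF.
Qed.

(** By bilinearity it is enough to multiply products of letters, and these are
    concatenated. *)
Lemma sum_components_qsh x y : D x -> D y -> D (qsh x y).
Proof.
have [D0 DZD] := sum_components_lin.
have DD (u v : T) : D u -> D v -> D (u + v).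
  by move=> Du Dv; rewrite -[u]scale1r; apply: DZD.
move=> [N [u [Eu ->]]] [N' [v [Ev ->]]].
rewrite -[qsh _ _]/(qshl _ _) linear_sum; apply: (big_ind D) => // i _.
apply: (sub_component (B := fun z => D (qsh z _))) (Eu i) => [|s _].
  split=> [|c z z' Dz Dz']; first by rewrite linear0l.
  by rewrite linearPl; apply: DZD.
rewrite linear_sumr; apply: (big_ind D) => // j _.
apply: (sub_component (B := fun z => D (qsh (letter_prod s) z))) (Ev j) => [|t _].
  split=> [|c z z' Dz Dz']; first by rewrite linear0r.
  by rewrite linearPr; apply: DZD.
by rewrite letter_prod_cat; apply/sub_sum_components/component_letter_prod.
Qed.

Lemma generated_subalgebra :
  smallest (fun B : set T => [/\ B (ten [::]),
      forall (c : K) x y, B x -> B y -> B (c *: x + y)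
    & forall x y, B x -> B y -> B (qsh x y)])
    (range (fun a : A => ten [:: a])) = D.
Proof.
apply/seteqP; split.
  apply: smallest_sub => [|_ [a _ <-]].
    split; [|by have [] := sum_components_lin|exact: sum_components_qsh].
    apply: (@sub_sum_components 0); rewrite -letter_prod_nil.
    exact: (component_letter_prod [::]).
  apply: (@sub_sum_components 1); have := component_letter_prod [:: a].
  by rewrite /letter_prod big_cons big_nil qshx1.
move=> _ [N [y [Ey ->]]] B [[B1 BZD Bqsh] BA].
have B0 : B 0 by rewrite -[0](addNr (ten [::])) -scaleN1r; apply: BZD.
have BD (u v : T) : B u -> B v -> B (u + v).
  by move=> Bu Bv; rewrite -[u]scale1r; apply: BZD.
apply: (big_ind B) => // i _; apply: (sub_component (B := B)) (Ey i) => // s _.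
elim: s => [|a s IHs]; first by rewrite letter_prod_nil.
rewrite /letter_prod big_cons -/(letter_prod s); apply: Bqsh => //.
by apply: BA; exists a.
Qed.

Lemma letter_prod_sum_and_generated :
  (forall n s, size s = n -> (0 < n)%N -> letter_prod s = perm_sum n (ten s))
  /\ smallest (fun B : set T => [/\ B (ten [::]),
         forall (c : K) x y, B x -> B y -> B (c *: x + y)
       & forall x y, B x -> B y -> B (qsh x y)])
       (range (fun a : A => ten [:: a])) = D.
Proof. by split; [exact: letter_prod_sum | exact: generated_subalgebra]. Qed.

End TensorCalculus.

(** * The case of the tensor algebra *)

Section TensorAlgebra.
Context (K : fieldType) (A : lmodType K).
Context (m : {bilinear A -> A -> A}) (sigma : {linear tpow A 2 -> tpow A 2}).
Local Notation T := (tensalg A).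
Local Notation tid := (idfun : {linear T -> T}).

Section Graded.
Context (h : nat -> {linear T -> T}).

Let graded_word (s : seq A) : T := h (size s) (ten s).

Lemma graded_word_multilinear : multilinear graded_word.
Proof.
by move=> s t c a b; rewrite /graded_word !size_cat /= ten_multilinear linearP.
Qed.

Definition graded_map : {linear T -> T} := tlift graded_word_multilinear.

Lemma graded_map_ten s : graded_map (ten s) = h (size s) (ten s).
Proof. exact: tlift_ten. Qed.

End Graded.

Lemma tensalg_span (x : T) : exists cs : seq (K * seq A),
  x = \sum_(c <- cs) c.1 *: ten c.2.
Proof.
exists [seq ((trepr x)@_s, s) | s <- msupp (trepr x)].
rewrite big_map -{1}[x]treprK {1}(monalgE (trepr x)) linear_sum.
apply: eq_bigr => s _ /=; rewrite /ten -linearZ; congr tpi.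
by apply/malgP => t; rewrite mcoeffZ !mcoeffU mulrnAr mulr1.
Qed.

Lemma text_homog (x : T) : tproj A 2 (text sigma x) = text sigma x.
Proof. by rewrite /text /=; case: (sigma _) => y /= /eqP. Qed.

Lemma text_ten0 s : size s <> 2 -> text sigma (ten s) = 0.
Proof.
move=> /eqP/negPf s2; rewrite /text /=.
have -> : tcomp 2 (ten s) = 0 by apply: val_inj; rewrite /= tproj_ten s2.
by rewrite linear0.
Qed.

Lemma mulT_ten s :
  mulT m (ten s) = if s is [:: a; b] then ten [:: m a b] else 0.
Proof. exact: tlift_ten. Qed.

Lemma sig_compE ks (x : T) : sig_comp sigma ks x = act_word (fun k => sig sigma k) ks x.
Proof. by elim: ks => //= k ks ->. Qed.

Lemma beta01 (x : T) : beta sigma 0 1 x = x.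
Proof. by []. Qed.

Lemma betaS1 i (x : T) : beta sigma i.+1 1 x = Tperm sigma (chi i.+1 1) x.
Proof. by []. Qed.

Lemma Tsum_imageS n (y : T) : Tsum_image m sigma n.+1 y <->
  exists2 x, x \in homog n.+1 & y = Tsum m sigma n.+1 x.
Proof.
split=> [[x _ <-]|[x xn ->]]; first by exists (val x); first exact: valP.
by exists (Tpow xn).
Qed.

Context (hA : braided_algebra m sigma).

Lemma braid_homog3 : {in homog 3, forall z : T,
  sig sigma 0 (sig sigma 1 (sig sigma 0 z))
  = sig sigma 1 (sig sigma 0 (sig sigma 1 z))}.
Proof. by move=> z z3; have [_ br] := ba_braid hA; apply: (br (Tpow z3)). Qed.

Lemma mull_homog3 : {in homog 3, forall z : T,
  tmap 1 tid (mulT m) (sig sigma 0 (sig sigma 1 z))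
  = text sigma (tmap 2 (mulT m) tid z)}.
Proof. by move=> z z3; apply: (ba_mull hA (Tpow z3)). Qed.

Lemma mulr_homog3 : {in homog 3, forall z : T,
  tmap 2 (mulT m) tid (sig sigma 1 (sig sigma 0 z))
  = text sigma (tmap 1 tid (mulT m) z)}.
Proof. by move=> z z3; apply: (ba_mulr hA (Tpow z3)). Qed.

End TensorAlgebra.

Theorem theorem5p2 (K : fieldType) (charK : [pchar K] =i pred0)
    (A : lmodType K) (m : {bilinear A -> A -> A})
    (sigma : {linear tpow A 2 -> tpow A 2})
    (hA : braided_algebra m sigma) :
  (forall (n : nat) (a : n.-tuple A), (1 <= n)%N ->
     \big[qshuffle m sigma/ten [::]]_(b <- a) ten [:: b]
     = \sum_(p : 'S_n * {set 'I_n * 'I_n} | p.2 \subset ascents p.1)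
         TpermS m sigma p.1 p.2 (ten a))
  /\ qsh_algebra m sigma = sum_subspaces (Tsum_image m sigma).
Proof.
have [sumE genE] := @letter_prod_sum_and_generated K A (tensalg A) (@ten K A)
  (@tens_ext K A _) (tcat A) (bil_ten _) (tproj A) (@tproj_ten K A)
  (@tmap K A) (@tmap_ten K A) (text sigma) (mulT m) m (text_homog sigma)
  (text_ten0 sigma) (mulT_ten m) (sig sigma) (fun=> erefl) (ba_assoc hA)
  (braid_homog3 hA) (mull_homog3 hA) (mulr_homog3 hA) (sig_comp sigma)
  (sig_compE sigma) (@graded_map K A) (@graded_map_ten K A) (@Tperm K A sigma)
  (fun _ _ _ => erefl) (fun i => beta sigma i 1) (beta01 sigma)
  (betaS1 sigma) (qshuffle_at m sigma) (fun=> erefl) (fun=> erefl) (fun _ _ _ => erefl)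
  (qshuffle m sigma) (bil_ten _) (mulpow m) (fun=> erefl) (fun _ _ => erefl)
  (mul_comp m) (fun=> erefl) (fun _ _ _ => erefl) (@tensalg_span K A)
  (Tsum_image m sigma) erefl (Tsum_imageS m sigma).
by split=> // n a n_gt0; apply: sumE (size_tuple a) n_gt0.
Qed.
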